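(* Let $(X,\mathcal{B},\mu,T)$ be a measure preserving $(\mathbb{N},\times)$-system and let $A\in\mathcal{B}$ with $\mu(A)>0$. Let $k\in\mathbb{N}$, let $f:\mathbb{N}^k\to\mathbb{N}$ be a commutative parametrized multiplicative function and let $\ell\in\mathbb{N}$. Then $$\liminf_{N\to\infty}\ \mathbb{E}_{n\in[N]^k}\ \mu\big(A\cap T_{f(n)}^{-1}A\cap T_{f(n)^2}^{-1}A\cap\cdots\cap T_{f(n)^\ell}^{-1}A\big)>0.$$
   Context: $\mathbb{N}=\{1,2,\dots\}$, $[N]=\{1,\dots,N\}$, and $\mathbb{E}_{n\in E}f(n):=\frac1{|E|}\sum_{n\in E}f(n)$ for a finite nonempty set $E$. A measure preserving $(\mathbb{N},\times)$-system $(X,\mathcal{B},\mu,T)$ consists of a probability space $(X,\mathcal{B},\mu)$ and measure preserving transformations $T_n:X\to X$, $n\in\mathbb{N}$, with $T_{nm}=T_n\circ T_m$ for all $n,m\in\mathbb{N}$. A semigroup $(\mathbb{N}^k,\ast)$ (i.e. $\ast$ is an associative operation on the set $\mathbb{N}^k$) is subordinated to the Euclidean norm $\|\cdot\|$ if there is a constant $C>0$ with $\|n\ast m\|\le C\|n\|\,\|m\|$ for all $n,m\in\mathbb{N}^k$. For $E\subset\mathbb{N}^k$, $\bar d_+(E):=\limsup_{N\to\infty}|E\cap[N]^k|/N^k$. A function $f:\mathbb{N}^k\to\mathbb{Q}^{\ge0}$ is a parametrized multiplicative function if $\bar d_+(\{n\in\mathbb{N}^k:f(n)=0\})=0$ and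 there is an operation $\ast:\mathbb{N}^k\times\mathbb{N}^k\to\mathbb{N}^k$ such that $(\mathbb{N}^k,\ast)$ is a semigroup subordinated to the Euclidean norm and $f(n\ast m)=f(n)f(m)$ for all $n,m\in\mathbb{N}^k$. It is a commutative parametrized multiplicative function if moreover $\ast$ can be chosen so that $(\mathbb{N}^k,\ast)$ is a cancelative commutative semigroup. *)

(* Defs.v *)
From HB Require Import structures.
From mathcomp Require Import all_boot all_order all_algebra.
From mathcomp Require Import all_classical all_reals all_analysis.

Set Implicit Arguments.
Unset Strict Implicit.
Unset Printing Implicit Defensive.

Import Order.TTheory GRing.Theory Num.Theory.
Import numFieldNormedType.Exports.

Local Open Scope classical_set_scope.
Local Open Scope ring_scope.

Record posnat := Posnat { posnat_val :> nat; posnat_gt0 : (0 < posnat_val)%N }.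

HB.instance Definition _ := [isSub for posnat_val].
HB.instance Definition _ := [Countable of posnat by <:].

Definition posnatS (n : nat) : posnat := Posnat (ltn0Sn n).

Lemma posnat_mul_gt0 (m n : posnat) : (0 < m * n)%N.
Proof. by rewrite muln_gt0 !posnat_gt0. Qed.

Definition posnat_mul (m n : posnat) : posnat := Posnat (posnat_mul_gt0 m n).

Lemma posnat_exp_gt0 (m : posnat) (j : nat) : (0 < m ^ j)%N.
Proof. by rewrite expn_gt0 posnat_gt0. Qed.

Definition posnat_exp (m : posnat) (j : nat) : posnat := Posnat (posnat_exp_gt0 m j).

Definition pvec (k : nat) := {ffun 'I_k -> posnat}.

Definition eucl_norm (R : realType) (k : nat) (n : pvec k) : R :=
  Num.sqrt (\sum_(i < k) ((n i : nat)%:R : R) ^+ 2).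

(* [N]^k is enumerated by the finite type {ffun 'I_k -> 'I_N}, where 'I_N
   starts at 0: hence the shift by one. *)
Definition box_pt (k N : nat) (n : {ffun 'I_k -> 'I_N}) : pvec k :=
  [ffun i => posnatS (n i)].

(* For k > 0 the value at N = 0 is 0; it does not affect limits in N. *)
Definition box_avg (R : realType) (k N : nat) (F : pvec k -> \bar R) : \bar R :=
  (((N ^ k)%:R^-1)%:E * \sum_(n : {ffun 'I_k -> 'I_N}) F (box_pt n))%E.

Definition upper_density (R : realType) (k : nat) (E : set (pvec k)) : \bar R :=
  limn_esup (fun N : nat =>
    (#|[pred n : {ffun 'I_k -> 'I_N} | `[< E (box_pt n) >]]|%:R
       / (N ^ k)%:R)%:E).

Definition subordinated (R : realType) (k : nat)
    (op : pvec k -> pvec k -> pvec k) : Prop :=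
  exists C : R, 0 < C /\
    forall n m : pvec k,
      eucl_norm R (op n m) <= C * eucl_norm R n * eucl_norm R m.

Definition comm_parametrized_multiplicative (R : realType) (k : nat)
    (f : pvec k -> rat) : Prop :=
  [/\ forall n, 0 <= f n,
      upper_density R [set n | f n = 0] = 0%E &
      exists op : pvec k -> pvec k -> pvec k,
        [/\ associative op,
            subordinated R op,
            forall n m, f (op n m) = f n * f m,
            commutative op &
            left_injective op /\ right_injective op]].

Definition measure_preserving (R : realType) (d : measure_display)
    (X : measurableType d) (mu : probability X R) (g : X -> X) : Prop :=
  measurable_fun setT g /\
  forall B : set X, measurable B -> mu (g @^-1` B) = mu B.

Definition mul_system (R : realType) (d : measure_display)
    (X : measurableType d) (mu : probability X R) (T : posnat -> X -> X) : Prop :=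
  (forall n, measure_preserving mu (T n)) /\
  (forall n m, T (posnat_mul n m) = T n \o T m).

(* Main.v *)
Require Import Defs.
From HB Require Import structures.
From mathcomp Require Import all_boot all_order all_algebra.
From mathcomp Require Import all_classical all_reals all_analysis.
From mathcomp Require Import measurable_realfun ring lra.

Set Implicit Arguments.
Unset Strict Implicit.
Unset Printing Implicit Defensive.

Import Order.TTheory GRing.Theory Num.Theory.
Import numFieldNormedType.Exports.

Local Open Scope classical_set_scope.
Local Open Scope ring_scope.

(** Since [f] turns the semigroup law of N^k into multiplication, the maps
    [T (f n)] form an action of that semigroup. It suffices to find a finite list
    [F] and [th > 0] such that every translate of [F] by an element [x] of the
    semigroup contains an element at which the return measure is at least [th].
    Translation by a fixed [b] is injective by cancellation and enlarges norms
    at most by a constant factor, so these elements then occupy a positive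
    proportion of every large box ([box_density]).

    Such an [F] exists as soon as, for some length, the subproducts of every
    sequence of that length contain an element with large return measure
    ([syndetic_of_IP]). This is a consequence of the density Hales-Jewett theorem:
    a word [w] over the letters 0, ..., ell, read as a list of exponents, gives
    the preimage of [A] under the map attached to the product of the
    [f (n_i) ^ w_i], an event of measure [mu A]; the events along a combinatorial
    line with wild set [S] form the progression of the [g0 * m ^ j], where [m] is
    the value of [f] at the subproduct indexed by [S] ([IP_recurrence]).

    The density Hales-Jewett theorem is proved by density increment, from an
    alphabet [K] to [option K]. Words over [option K] are also lines over [K],
    which is used throughout. Let [A] be line-free of density [d].

    - In a random subspace chosen as in [exists_spread] every point is almost
      uniform, so [A] may be replaced by a family of line-free sets on a probability
      space, such that every word is in the set with probability almost [d].
    - By the theorem for [K] and [line_levels], there is a random subspace in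
      which, for a proportion [th] of the points [x], all the words obtained by
      substituting a letter of [K] for the extra letter of [x] belong to [A]. As [A]
      is line-free, no such [x] is in [A]. Thus [A] avoids a set [D] of density
      [th], and has density more than [d] in the complement of [D].
    - [D] is an intersection of sets [D_a], one for each letter [a], that do not
      distinguish [a] from the extra letter. A subspace over [K] contained in such a
      set extends to one over [option K]; hence, by the theorem for [K], [D_a] and
      its complement can be exhausted by subspaces up to a small density
      ([exhaust_insens]), and so can the complement of [D]. On one of these
      subspaces [A] has density at least [d + g].

    The gain [g] depends only on a lower bound for [d], so that repeating the
    step would lead to a density above 1 ([DHJ_option]). *)

(** * Averages over finite types *)

Section Averages.
Variable R : archiRealFieldType.

Definition avg (W : finType) (f : W -> R) : R := (\sum_w f w) / #|W|%:R.

Lemma eq_avg (W : finType) (f g : W -> R) : f =1 g -> avg f = avg g.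
Proof. by move=> fg; congr (_ / _); apply: eq_bigr => w _; apply: fg. Qed.

Lemma ler_avg (W : finType) (f g : W -> R) :
  (forall w, f w <= g w) -> avg f <= avg g.
Proof. by move=> fg; rewrite ler_wpM2r ?invr_ge0 ?ler_sum. Qed.

Lemma avgD (W : finType) (f g : W -> R) :
  avg (fun w => f w + g w) = avg f + avg g.
Proof. by rewrite /avg big_split mulrDl. Qed.

Lemma avgN (W : finType) (f : W -> R) : avg (fun w => - f w) = - avg f.
Proof. by rewrite /avg sumrN mulNr. Qed.

Lemma avgB (W : finType) (f g : W -> R) :
  avg (fun w => f w - g w) = avg f - avg g.
Proof. by rewrite avgD avgN. Qed.

Lemma avgZ (W : finType) (c : R) (f : W -> R) :
  avg (fun w => c * f w) = c * avg f.
Proof. by rewrite /avg -mulr_sumr mulrA. Qed.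

Lemma avg_sum (W : finType) (I : Type) (r : seq I) (P : pred I) (f : I -> W -> R) :
  avg (fun w => \sum_(i <- r | P i) f i w) = \sum_(i <- r | P i) avg (f i).
Proof. by rewrite /avg exchange_big mulr_suml. Qed.

Lemma avg_cst (W : finType) (c : R) : (0 < #|W|)%N -> avg (fun _ : W => c) = c.
Proof.
move=> W0; rewrite /avg sumr_const -[c *+ _]mulr_natr mulfK //.
by rewrite pnatr_eq0 -lt0n.
Qed.

Lemma avg_unit (f : unit -> R) : avg f = f tt.
Proof.
by rewrite (@eq_avg _ _ (fun=> f tt)) ?avg_cst ?card_unit // => -[].
Qed.

Lemma avg_ge0 (W : finType) (f : W -> R) : (forall w, 0 <= f w) -> 0 <= avg f.
Proof. by move=> f0; rewrite /avg divr_ge0 ?sumr_ge0. Qed.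

Lemma avg_le1 (W : finType) (f : W -> R) : (forall w, f w <= 1) -> avg f <= 1.
Proof.
move=> f1; have [W0|W0] := posnP #|W|; first by rewrite /avg W0 invr0 mulr0.
by rewrite -[leRHS](avg_cst 1 W0) ler_avg.
Qed.

Lemma avg_exchange (W W' : finType) (f : W -> W' -> R) :
  avg (fun w => avg (f w)) = avg (fun w' => avg (f^~ w')).
Proof.
rewrite /avg -!mulr_suml exchange_big /=.
exact: mulrAC.
Qed.

Lemma avg_pair (W W' : finType) (f : W * W' -> R) :
  avg f = avg (fun w => avg (fun w' => f (w, w'))).
Proof.
rewrite /avg -mulr_suml pair_bigA card_prod natrM invfM.
rewrite [_^-1 * _]mulrC mulrA; congr (_ * _ * _).
by apply: eq_bigr => -[].
Qed.

Lemma avg_reindex (W W' : finType) (e : W -> W') (f : W' -> R) :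
  bijective e -> avg f = avg (f \o e).
Proof.
move=> be; rewrite /avg (bij_eq_card be); congr (_ / _).
exact/reindex/onW_bij.
Qed.

Lemma le_avg_exists (W : finType) (t : R) (f : W -> R) :
  (0 < #|W|)%N -> t <= avg f -> exists w, t <= f w.
Proof.
move=> W0 tf; have [w0 _] := card_gt0P W0; apply/existsP; apply: contraTT tf.
rewrite negb_exists => /forallP ft.
have {}ft w : f w < t by rewrite ltNge ft.
rewrite -ltNge -subr_gt0 -(avg_cst t W0) -avgB divr_gt0 ?ltr0n //.
rewrite (bigD1 w0) //= ltr_wpDr ?subr_gt0 // sumr_ge0 // => w _.
by rewrite subr_ge0 ltW.
Qed.

Lemma avg_wide (W W' : finType) (f : W -> R) :
  (0 < #|W'|)%N -> avg f = avg (fun _ : W' => avg f).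
Proof. by move=> W0; rewrite avg_cst. Qed.

Lemma ler_norm_avg (W : finType) (f : W -> R) :
  `|avg f| <= avg (fun w => `|f w|).
Proof. by rewrite /avg normrM normfV normr_nat ler_wpM2r ?invr_ge0 ?ler_norm_sum. Qed.

Lemma ler_dist_avg (W : finType) (e : R) (f g : W -> R) : 0 <= e ->
  (forall w, `|f w - g w| <= e) -> `|avg f - avg g| <= e.
Proof.
move=> e0 fg; rewrite -avgB; apply: le_trans (ler_norm_avg _) _.
have [W0|W0] := posnP #|W|; first by rewrite /avg W0 invr0 mulr0.
by rewrite -[leRHS](avg_cst e W0) ler_avg.
Qed.

End Averages.

(** * Words, lines and subspaces *)

(** Blocks of coordinates are assembled by disjoint sums, so that a property
    of all of them is proved by adding one coordinate at a time, up to bijection. *)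
Lemma finType_ind (P : finType -> Prop) :
  P void -> (forall J : finType, P J -> P (unit + J)%type) ->
  (forall (J J' : finType) (e : J -> J'), bijective e -> P J -> P J') ->
  forall J, P J.
Proof.
move=> P0 PS Pbij J.
apply: (Pbij 'I_#|J| _ enum_val); first exact: enum_val_bij.
elim: {J} #|J| => [|n IH].
  apply: (Pbij _ _ (of_void 'I_0)) P0.
  by exists (fun i : 'I_0 => False_rect _ (notF (ltn_ord i))) => -[].
pose e (x : unit + 'I_n) : 'I_n.+1 := if x is inr i then lift ord0 i else ord0.
apply: (Pbij _ _ e) (PS _ IH).
exists (fun i => if unlift ord0 i is Some j then inr j else inl tt).
  by case=> [[]|i] /=; rewrite ?unlift_none ?liftK.
by move=> i; case: unliftP => [j ->|->].
Qed.

Notation word K I := {ffun I -> K} (only parsing).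
Notation space K J I := {ffun I -> K + J} (only parsing).

Section Words.

(** A line of [word K I] is encoded as a word over [option K], [None] marking
    the wild coordinates: the points over one alphabet are the lines over the
    previous one. *)
Definition fill (K I : finType) (l : word (option K) I) (a : K) : word K I :=
  [ffun c => odflt a (l c)].

Definition proper_line (K I : finType) (l : word (option K) I) :=
  [exists c, l c == None].

Definition emb (K I : finType) (w : word K I) : word (option K) I :=
  [ffun c => Some (w c)].

(** [V] parametrizes a subspace: a coordinate is either constant or a copy of
    one of the parameters. *)
Definition inst (K J I : finType) (V : space K J I) (x : word K J) : word K I :=
  [ffun c => match V c with inl a => a | inr j => x j end].

Definition nondeg (K J I : finType) (V : space K J I) :=
  forall j, exists c, V c = inr j.

Definition nondegb (K J I : finType) (V : space K J I) :=
  [forall j, [exists c, V c == inr j]].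

Lemma nondegP (K J I : finType) (V : space K J I) : reflect (nondeg V) (nondegb V).
Proof.
apply: (iffP forallP) => h j; first by have /existsP[c /eqP] := h j; exists c.
by have [c Vc] := h j; apply/existsP; exists c; rewrite Vc.
Qed.

Definition compsp (K L J I : finType) (V : space K J I) (W : space K L J) :
    space K L I :=
  [ffun c => match V c with inl a => inl a | inr j => W j end].

(** Over the larger alphabet, [V] still parametrizes a subspace; applied to
    words read as lines, it maps the lines of the parameter space to lines
    ([fill_inst]). *)
Definition liftsp (K J I : finType) (V : space K J I) : space (option K) J I :=
  [ffun c => match V c with inl a => inl (Some a) | inr j => inr j end].

Lemma inst_comp (K L J I : finType) (V : space K J I) (W : space K L J) x :
  inst (compsp V W) x = inst V (inst W x).
Proof. by apply/ffunP => c; rewrite !ffunE; case: (V c) => // j; rewrite ffunE. Qed.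

Lemma nondeg_comp (K L J I : finType) (V : space K J I) (W : space K L J) :
  nondeg V -> nondeg W -> nondeg (compsp V W).
Proof.
move=> Vnd Wnd l; have [j Wj] := Wnd l; have [c Vc] := Vnd j.
by exists c; rewrite ffunE Vc.
Qed.

Lemma nondeg_lift (K J I : finType) (V : space K J I) :
  nondeg V -> nondeg (liftsp V).
Proof. by move=> Vnd j; have [c Vc] := Vnd j; exists c; rewrite ffunE Vc. Qed.

Lemma inst_inj (K J I : finType) (V : space K J I) : nondeg V -> injective (inst V).
Proof.
move=> Vnd x y /ffunP xy; apply/ffunP => j; have [c Vc] := Vnd j.
by have := xy c; rewrite !ffunE Vc.
Qed.

Lemma inst_emb (K J I : finType) (V : space K J I) x :
  inst (liftsp V) (emb x) = emb (inst V x).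
Proof. by apply/ffunP => c; rewrite !ffunE; case: (V c) => // j; rewrite ffunE. Qed.

Lemma fill_inst (K J I : finType) (V : space K J I) l a :
  fill (inst (liftsp V) l) a = inst V (fill l a).
Proof. by apply/ffunP => c; rewrite !ffunE; case: (V c) => // j; rewrite ffunE. Qed.

Lemma proper_inst (K J I : finType) (V : space K J I) l :
  nondeg V -> proper_line l -> proper_line (inst (liftsp V) l).
Proof.
move=> Vnd /existsP[j /eqP lj]; have [c Vc] := Vnd j.
by apply/existsP; exists c; rewrite !ffunE Vc lj.
Qed.

Definition linefree (K I : finType) (A : pred (word K I)) :=
  forall l, proper_line l -> exists a, ~~ A (fill l a).

Lemma linefree_inst (K J I : finType) (V : space K J I) (A : pred (word K I)) :
  nondeg V -> linefree A -> linefree (fun x => A (inst V x)).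
Proof.
move=> Vnd Alf l pl; have [a Aa] := Alf _ (proper_inst Vnd pl).
by exists a; rewrite -fill_inst.
Qed.

Definition wcat (K I J : finType) (u : word K I) (v : word K J) :
    word K (I + J)%type :=
  [ffun c => match c with inl i => u i | inr j => v j end].

Definition wsplit (K I J : finType) (w : word K (I + J)%type) :
    word K I * word K J := ([ffun i => w (inl i)], [ffun j => w (inr j)]).

Lemma wcat_bij (K I J : finType) :
  bijective (fun p : word K I * word K J => wcat p.1 p.2).
Proof.
exists (@wsplit K I J) => [[u v]|w].
  by congr (_, _); apply/ffunP => c; rewrite !ffunE.
by apply/ffunP => -[c|c]; rewrite !ffunE.
Qed.

Lemma card_word_gt0 (K I : finType) : (0 < #|K|)%N -> (0 < #|{: word K I}|)%N.
Proof. by move=> K0; rewrite card_ffun expn_gt0 K0. Qed.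

Lemma avg_wcat (R : archiRealFieldType) (K I J : finType)
    (f : word K (I + J)%type -> R) :
  avg f = avg (fun u => avg (fun v => f (wcat u v))).
Proof. by rewrite (avg_reindex f (wcat_bij K I J)) avg_pair. Qed.

End Words.

(** * Random subspaces whose points are almost uniform *)

Section Spread.
Variables (R : archiRealFieldType) (K : finType).
Hypothesis K_gt0 : (0 < #|K|)%N.

(** [V] is a random subspace, [Sm] being its sample space: the point with any
    fixed parameter [x] is within [eps] of being uniformly distributed. *)
Definition spread (eps : R) (J I Sm : finType) (V : Sm -> space K J I) :=
  [/\ (0 < #|Sm|)%N, forall o, nondeg (V o) &
   forall (x : word K J) (f : word K I -> R), (forall w, 0 <= f w <= 1) ->
     `|avg (fun o => f (inst (V o) x)) - avg f| <= eps].

Definition upd (I : finType) (y : word K I) (t : I) (a : K) : word K I :=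
  [ffun c => if c == t then a else y c].

Lemma avg_pick (a : K) (h : K -> R) :
  avg (fun b => h b * (#|K|%:R * (b == a)%:R)) = h a.
Proof.
rewrite /avg (bigD1 a) //= eqxx mulr1 big1 ?addr0 ?mulfK //.
  by rewrite pnatr_eq0 -lt0n.
by move=> b /negPf ->; rewrite !mulr0.
Qed.

(** Overwriting a letter by [a] multiplies the uniform measure by the density
    [#|K| * (y t == a)]: exchange the overwritten letter with the new one. *)
Lemma avg_upd (I : finType) (t : I) (a : K) (g : word K I -> R) :
  avg (fun y => g (upd y t a)) =
  avg (fun y => g y * (#|K|%:R * (y t == a)%:R)).
Proof.
pose F (p : word K I * K) := g p.1 * (#|K|%:R * (p.1 t == a)%:R).
pose s (p : word K I * K) := (upd p.1 t p.2, p.1 t).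
have sK : involutive s.
  move=> [y b]; rewrite /s /= ffunE eqxx; congr (_, _).
  by apply/ffunP => c; rewrite !ffunE; case: eqP => [->|].
have -> : avg (fun y => g y * (#|K|%:R * (y t == a)%:R)) = avg F.
  by rewrite avg_pair; apply: eq_avg => y; rewrite /F /= avg_cst.
rewrite (avg_reindex F (inv_bij sK)) avg_pair; apply: eq_avg => y.
rewrite -(avg_pick a (fun b => g (upd y t b))); apply: eq_avg => b.
by rewrite /F /= ffunE eqxx.
Qed.

(** Second moment method: the density of the overwritten word at a random
    position is an average of [q] pairwise uncorrelated variables of mean 1. *)
Lemma spread_point (eps : R) : 0 < eps ->
  exists (q : nat) (V : 'I_q * word K 'I_q -> space K unit 'I_q), spread eps V.
Proof.
move=> e0; set k : R := #|K|%:R.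
have k0 : 0 <= k by rewrite ler0n.
(* [k / q] bounds the variance of the density below; it has to be at most
   [eps ^+ 2]. *)
pose q := (Num.bound (k / eps ^+ 2)).+1.
have q0 : 0 < q%:R :> R by rewrite ltr0n.
have kq : k <= q%:R * eps ^+ 2.
  rewrite -ler_pdivrMr ?exprn_gt0 //; apply: ltW.
  have /archi_boundP b : 0 <= k / eps ^+ 2 by rewrite divr_ge0 ?sqr_ge0.
  by apply: (lt_le_trans b); rewrite ler_nat /q leqnSn.
pose V (p : 'I_q * word K 'I_q) : space K unit 'I_q :=
  [ffun c => if c == p.1 then inr tt else inl (p.2 c)].
exists q, V.
have W0 := card_word_gt0 'I_q K_gt0.
split; first by rewrite card_prod card_ord muln_gt0 W0.
  by move=> [t y] []; exists t; rewrite ffunE eqxx.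
move=> x f f01; set a := x tt.
pose h (t : 'I_q) (y : word K 'I_q) : R := k * (y t == a)%:R - 1.
have h0 g t : (forall y b, g (upd y t b) = g y) -> avg (fun y => g y * h t y) = 0.
  move=> gt; rewrite (@eq_avg _ _ _ (fun y => g y * (k * (y t == a)%:R) - g y)).
    rewrite avgB -avg_upd (eq_avg (g := g)) ?subrr // => y.
  by move=> y; rewrite /h mulrBr mulr1.
have hh t t' : avg (fun y => h t y * h t' y) = (t == t')%:R * (k - 1).
  have [<-|tt'] := eqVneq t t'; last first.
    rewrite mul0r; apply: h0 => y b; rewrite /h ffunE.
    by rewrite (negPf tt').
  rewrite mul1r.
  rewrite (@eq_avg _ _ _ (fun y => h t y * (k * (y t == a)%:R) - h t y)); last first.
    by move=> y; rewrite {2}/h mulrBr mulr1.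
  rewrite avgB -avg_upd (@eq_avg _ _ (fun y => h t (upd y t a)) (fun=> k - 1)).
    rewrite avg_cst // (@eq_avg _ _ (h t) (fun y => 1 * h t y)) ?h0 ?subr0 //.
    by move=> y; rewrite mul1r.
  by move=> y; rewrite /h ffunE !eqxx mulr1.
pose H y := (q%:R)^-1 * \sum_t h t y.
have HH : avg (fun y => H y ^+ 2) <= eps ^+ 2.
  rewrite (@eq_avg _ _ _ (fun y => q%:R ^- 2 * \sum_t \sum_t' h t y * h t' y)).
    rewrite avgZ avg_sum (eq_bigr (fun=> k - 1)); last first.
      move=> t _; rewrite avg_sum (bigD1 t) //= hh eqxx mul1r big1 ?addr0 //.
      by move=> t' tt'; rewrite hh eq_sym (negPf tt') mul0r.
    rewrite sumr_const card_ord -[(k - 1) *+ q]mulr_natl mulrA expr2 invfM -(mulrA _^-1).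
    rewrite mulVf ?gt_eqF // mulr1 mulrC ler_pdivrMr // mulrC.
    by rewrite (le_trans _ kq) // gerBl.
  move=> y; rewrite /H exprMn exprVn; congr (_ * _); rewrite expr2 mulr_suml.
  by apply: eq_bigr => t _; rewrite mulr_sumr.
have -> : avg (fun o => f (inst (V o) x)) - avg f = avg (fun y => f y * H y).
  rewrite avg_pair (@eq_avg _ _ _ (fun t => avg (fun y => f y * h t y) + avg f)).
    rewrite avgD avg_cst ?card_ord // addrK avg_exchange; apply: eq_avg => y.
    by rewrite avgZ /avg card_ord /H [RHS]mulrCA mulrA [RHS]mulrC.
  move=> t /=; rewrite -avgD.
  rewrite (@eq_avg _ _ (fun y => f y * h t y + f y)
    (fun y => f y * (k * (y t == a)%:R))); last by move=> y; rewrite /h; ring.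
  rewrite -avg_upd; apply: eq_avg => y; congr (f _).
  by apply/ffunP => c; rewrite !ffunE; case: eqP.
(* Cauchy-Schwarz, in the form 2 z <= eps + z ^+ 2 / eps. *)
apply: (le_trans (ler_norm_avg _)).
have : avg (fun y => 2 * `|f y * H y|) <= avg (fun y => eps + eps^-1 * H y ^+ 2).
  apply: ler_avg => y; rewrite normrM -(real_normK (num_real (H y))).
  have /andP[fy0 fy1] := f01 y; rewrite (ger0_norm fy0).
  set z := `|H y|; have z0 : 0 <= z by rewrite normr_ge0.
  have : 0 <= eps^-1 * (eps - z) ^+ 2 by rewrite mulr_ge0 ?invr_ge0 ?sqr_ge0 ?ltW.
  have -> : eps^-1 * (eps - z) ^+ 2 = eps - 2 * z + eps^-1 * z ^+ 2.
    by field; rewrite gt_eqF.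
  have : f y * z <= z by rewrite ler_piMl.
  lra.
rewrite avgZ avgD avgZ avg_cst //.
have : eps^-1 * avg (fun y => H y ^+ 2) <= eps.
  by rewrite mulrC ler_pdivrMr // -expr2.
lra.
Qed.

(** Each of the two laws is replaced by the uniform one in turn. *)
Lemma spread_sum (e1 e2 : R) (J1 I1 Sm1 J2 I2 Sm2 : finType)
    (V1 : Sm1 -> space K J1 I1) (V2 : Sm2 -> space K J2 I2) :
  spread e1 V1 -> spread e2 V2 ->
  exists V : Sm1 * Sm2 -> space K (J1 + J2)%type (I1 + I2)%type,
    spread (e1 + e2) V.
Proof.
move=> [Sm1_gt0 n1 s1] [Sm2_gt0 n2 s2].
pose V (o : Sm1 * Sm2) : space K (J1 + J2)%type (I1 + I2)%type :=
  [ffun c => match c with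
   | inl c => match V1 o.1 c with inl a => inl a | inr j => inr (inl j) end
   | inr c => match V2 o.2 c with inl a => inl a | inr j => inr (inr j) end end].
exists V; split; first by rewrite card_prod muln_gt0 Sm1_gt0.
  move=> [p1 p2] [j|j].
    by have [c Vc] := n1 p1 j; exists (inl c); rewrite ffunE /= Vc.
  by have [c Vc] := n2 p2 j; exists (inr c); rewrite ffunE /= Vc.
move=> x f f01.
have -> : avg (fun o => f (inst (V o) x)) =
    avg (fun o1 => avg (fun o2 =>
      f (wcat (inst (V1 o1) (wsplit x).1) (inst (V2 o2) (wsplit x).2)))).
  rewrite avg_pair; apply: eq_avg => o1; apply: eq_avg => o2; congr (f _).
  apply/ffunP => -[c|c]; rewrite !ffunE /=.
    by case: (V1 o1 c) => // j; rewrite ffunE.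
  by case: (V2 o2 c) => // j; rewrite ffunE.
set u := (wsplit x).1; set v := (wsplit x).2.
have W1 := card_word_gt0 I1 K_gt0.
pose g (w : word K I1) := avg (fun o2 => f (wcat w (inst (V2 o2) v))).
have := s1 u g; set d1 := avg _ - avg _ => d1e.
have d2e : `|avg g - avg f| <= e2.
  rewrite avg_wcat -avgB; apply: (le_trans (ler_norm_avg _)).
  rewrite -[leRHS](avg_cst e2 W1); apply: ler_avg => w.
  exact: (s2 v (fun z => f (wcat w z))).
rewrite -(subrKA (avg g)); apply: (le_trans (ler_normD _ _)).
apply: lerD d2e; apply: d1e => w; rewrite avg_ge0 ?avg_le1 //.
  by move=> o; case/andP: (f01 (wcat w (inst (V2 o) v))).
by move=> o; case/andP: (f01 (wcat w (inst (V2 o) v))).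
Qed.

Lemma spread_bij (eps : R) (J J' I Sm : finType) (e : J -> J')
    (V : Sm -> space K J I) :
  bijective e -> spread eps V ->
  exists V' : Sm -> space K J' I, spread eps V'.
Proof.
move=> [e' eK e'K] [Sm_gt0 Vnd Vs].
exists (fun o => [ffun c => match V o c with inl a => inl a | inr j => inr (e j) end]).
split=> //.
  move=> o j; have [c Vc] := Vnd o (e' j); exists c.
  by rewrite ffunE Vc e'K.
move=> x f f01; rewrite (le_trans _ (Vs [ffun j => x (e j)] f f01)) //.
rewrite le_eqVlt; apply/orP; left; apply/eqP; congr `|_ - _|; apply: eq_avg => o.
congr (f _); apply/ffunP => c; rewrite !ffunE.
by case: (V o c) => // j; rewrite ffunE.
Qed.

Lemma exists_spread (J : finType) (eps : R) : 0 < eps ->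
  exists (I Sm : finType) (V : Sm -> space K J I), spread eps V.
Proof.
elim/finType_ind: J eps => [|J IH|J J' e be IH] eps e0.
- exists void, unit, (fun _ => [ffun c : void => of_void _ c]).
  split=> [|_ []|x f f01]; rewrite ?card_unit //.
  rewrite (_ : avg _ - _ = 0) ?normr0 ?(ltW e0) //; apply/eqP; rewrite subr_eq0.
  apply/eqP; have all_eq (w w' : word K void) : w = w' by apply/ffunP => -[].
  rewrite (@eq_avg _ _ f (fun=> f x)) => [|w]; last by congr f.
  rewrite (@eq_avg _ _ _ (fun=> f x)) => [|w]; last by congr f.
  by rewrite !avg_cst ?card_unit ?card_word_gt0.
- have e20 : 0 < eps / 2 by rewrite divr_gt0.
  have [q [V1 s1]] := spread_point e20.
  have [I2 [Sm2 [V2 s2]]] := IH _ e20.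
  have [V sV] := spread_sum s1 s2.
  by exists ('I_q + I2)%type, ('I_q * word K 'I_q * Sm2)%type, V; rewrite [eps]splitr.
- have [I [Sm [V sV]]] := IH _ e0.
  by have [V' sV'] := spread_bij be sV; exists I, Sm, V'.
Qed.

End Spread.

(** * Lines and subspaces in families of events *)

Definition DHJ (R : archiRealFieldType) (K : finType) := forall d : R, 0 < d ->
  exists I : finType, forall A : pred (word K I),
    linefree A -> avg (fun w => (A w)%:R) < d.

Section Events.
Variables (R : archiRealFieldType) (K : finType).
Hypothesis K_gt0 : (0 < #|K|)%N.
Hypothesis dhj : DHJ R K.

Definition lines_in (I : finType) (A : pred (word K I)) : R :=
  \sum_(l : word (option K) I | proper_line l) [forall a, A (fill l a)]%:R.

(** Either [A] is line-free, hence sparse, or some line contributes 1. As an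
    inequality valid for all [A], it can be averaged over a probability space. *)
Lemma density_le_lines (d : R) : 0 < d -> exists I : finType,
  forall A : pred (word K I), avg (fun w => (A w)%:R) <= d + lines_in A.
Proof.
move=> d0; have [I HI] := dhj d0; exists I => A.
have l0 : 0 <= lines_in A by rewrite sumr_ge0.
have [/existsP[l /andP[pl Al]]|nl] :=
  boolP [exists l, proper_line l && [forall a, A (fill l a)]].
  apply: (@le_trans _ _ 1); first by apply: avg_le1 => w; case: (A w); rewrite ?ler01.
  rewrite /lines_in (bigD1 l) //= Al.
  by rewrite addrCA lerDl addr_ge0 ?(ltW d0) ?sumr_ge0.
apply: le_trans (_ : d <= _); last by rewrite lerDl.
apply/ltW/HI => l pl; move: nl; rewrite negb_exists => /forallP/(_ l).
by rewrite pl /= negb_forall => /existsP.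
Qed.

(** Average [density_le_lines] over the sample space: some line among the
    finitely many ones must account for its share. *)
Lemma line_of_events (d : R) : 0 < d -> exists (I : finType) (th : R), 0 < th /\
  forall (Sm : finType) (B : word K I -> pred Sm),
    (forall w, d <= avg (fun o => (B w o)%:R)) ->
  exists l, proper_line l /\ th <= avg (fun o => [forall a, B (fill l a) o]%:R).
Proof.
move=> d0; have d20 : 0 < d / 2 by rewrite divr_gt0.
have [I HI] := density_le_lines d20.
pose m := #|{: word (option K) I}|.
have m0 : 0 < m%:R :> R.
  by rewrite ltr0n card_word_gt0 // card_option.
pose th := (d / 4) / m%:R.
have th0 : 0 < th by rewrite !divr_gt0.
exists I, th; split=> // Sm B dB.
have [/existsP[l /andP[pl]]|nl] := boolP [exists l, proper_line l &&
    (th <= avg (fun o => [forall a, B (fill l a) o]%:R))].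
  by exists l.
have W0 := card_word_gt0 I K_gt0.
have Sm0 : (0 < #|Sm|)%N.
  have [w0 _] := card_gt0P W0.
  case: (posnP #|Sm|) => // O0; have := dB w0.
  by rewrite /avg O0 invr0 mulr0 leNgt d0.
have : d <= d / 2 + d / 4; last by lra.
rewrite -{1}(avg_cst d W0); apply: le_trans (ler_avg dB) _.
rewrite avg_exchange.
apply: le_trans (ler_avg (fun o => HI (fun w => B w o))) _.
rewrite avgD avg_cst // lerD2l /lines_in avg_sum.
have -> : d / 4 = \sum_(l : word (option K) I) th.
  by rewrite sumr_const -[_ *+ #|_|]mulr_natr /th divfK // gt_eqF.
rewrite big_mkcond; apply: ler_sum => l _.
case: ifP => pl; last exact: ltW.
move: nl; rewrite negb_exists => /forallP/(_ l).
by rewrite pl /= -ltNge => /ltW.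
Qed.

(** Dimensions add up: the subspaces found in the second block of coordinates
    are finitely many, hence may be made part of the probability space in
    which the line in the first block is found. *)
Lemma subspace_of_events (J : finType) (d : R) : 0 < d ->
  exists (I : finType) (th : R), 0 < th /\
  forall (Sm : finType) (B : word K I -> pred Sm),
    (forall w, d <= avg (fun o => (B w o)%:R)) ->
  exists V : space K J I, nondeg V /\
    th <= avg (fun o => [forall x, B (inst V x) o]%:R).
Proof.
elim/finType_ind: J d => [|J IH|J J' e be IH] d d0.
- exists void, d; split=> // Sm B dB.
  pose w0 : word K void := [ffun c => of_void _ c].
  exists [ffun c => of_void _ c]; split=> [[]|].
  apply: le_trans (dB w0) _; apply: ler_avg => o.
  have all_eq (w : word K void) : w = w0 by apply/ffunP => -[].
  rewrite ler_nat; case: (boolP (B w0 o)) => // Bo.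
  by rewrite lt0b; apply/forallP => x; rewrite (all_eq (inst _ x)).
- have [I2 [th2 [th20 H2]]] := IH _ d0.
  pose S := space K J I2; pose n := #|{: S}|.
  have S0 : (0 < n)%N.
    by rewrite /n /S card_ffun expn_gt0 card_sum addn_gt0 K_gt0.
  have n0 : 0 < n%:R :> R by rewrite ltr0n.
  have d'0 : 0 < th2 / n%:R by rewrite divr_gt0.
  have [I1 [th [th0 H1]]] := line_of_events d'0.
  exists (I1 + I2)%type, th; split=> // Sm B dB.
  (* A first-block word [u] and a subspace of the second block are compatible
     with the outcome if the events hold on the whole copy of the subspace over [u]. *)
  pose B' (u : word K I1) (p : S * Sm) :=
    nondegb p.1 && [forall x, B (wcat u (inst p.1 x)) p.2].
  have dB' u : th2 / n%:R <= avg (fun p => (B' u p)%:R).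
    have [V [/nondegP Vnd HV]] := H2 Sm (fun v => B (wcat u v)) (fun v => dB _).
    rewrite avg_pair {1}/avg ler_wpM2r ?invr_ge0 //.
    rewrite (bigD1 V) //= ler_wpDr ?sumr_ge0 //.
      by move=> W _; apply: avg_ge0.
    by apply: le_trans HV _; apply: ler_avg => o; rewrite /B' /= Vnd.
  have [l [pl Hl]] := H1 _ B' dB'.
  have [V HV] : exists V, th <= avg (fun o => [forall a, B' (fill l a) (V, o)]%:R).
    by apply: le_avg_exists => //; move: Hl; rewrite avg_pair.
  have [/nondegP Vnd|/negPf nV] := boolP (nondegb V); last first.
    have [a _] := card_gt0P K_gt0.
    suff H0 : avg (fun o => [forall a, B' (fill l a) (V, o)]%:R) <= 0 :> R.
      by move: (le_trans HV H0); rewrite leNgt th0.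
    rewrite -oppr_ge0 -avgN; apply: avg_ge0 => o.
    by case: forallP => [/(_ a)|]; rewrite /B' /= ?nV ?oppr0.
  exists [ffun c => match c with
    | inl c => if l c is Some a then inl a else inr (inl tt)
    | inr c => match V c with inl a => inl a | inr j => inr (inr j) end end].
  split=> [[[]|j]|].
  + have /existsP[c /eqP lc] := pl.
    by exists (inl c); rewrite ffunE lc.
  + by have [c Vc] := Vnd j; exists (inr c); rewrite ffunE Vc.
  apply: le_trans HV _; apply: ler_avg => o; rewrite ler_nat.
  case: forallP => // Ho; rewrite lt0b; apply/forallP => x.
  have /andP[_ /forallP/(_ (wsplit x).2)] := Ho (x (inl tt)).
  congr (B _ _); apply/ffunP => -[c|c]; rewrite !ffunE /=.
    by case: (l c).
  by case: (V c) => // j; rewrite ffunE.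
- have [I [th [th0 HI]]] := IH _ d0; exists I, th; split=> // Sm B dB.
  have [V [Vnd HV]] := HI _ _ dB; have [e' eK e'K] := be.
  exists [ffun c => match V c with inl a => inl a | inr j => inr (e j) end].
  split=> [j|].
    by have [c Vc] := Vnd (e' j); exists c; rewrite ffunE Vc e'K.
  apply: le_trans HV _; apply: ler_avg => o; rewrite ler_nat.
  case: forallP => // Ho; rewrite lt0b; apply/forallP => x.
  have := Ho [ffun j => x (e j)]; congr (B _ _); apply/ffunP => c.
  by rewrite !ffunE; case: (V c) => // j; rewrite ffunE.
Qed.

End Events.

(** * Insensitive sets *)

Section Insensitive.
Variables (R : archiRealFieldType) (K : finType).
Hypothesis K_gt0 : (0 < #|K|)%N.
Hypothesis dhj : DHJ R K.

Definition to (I : finType) (a : K) (x : word (option K) I) := emb (fill x a).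

Definition insens (I : finType) (a : K) (E : pred (word (option K) I)) :=
  forall x, E (to a x) = E x.

Lemma to_inst (J I : finType) (V : space (option K) J I) a x :
  to a (inst V (to a x)) = to a (inst V x).
Proof. by apply/ffunP => c; rewrite !ffunE; case: (V c) => // j; rewrite !ffunE. Qed.

Lemma insens_inst (J I : finType) (V : space (option K) J I) a E :
  insens a E -> insens a (fun x => E (inst V x)).
Proof. by move=> Ea x; rewrite -Ea to_inst Ea. Qed.

Lemma insens_cat (I J : finType) a (E : pred (word (option K) (I + J)%type)) u v :
  insens a E -> E (wcat (to a u) v) = E (wcat u v).
Proof.
move=> Ea; rewrite -Ea -[RHS]Ea; congr (E _).
by apply/ffunP => -[c|c]; rewrite !ffunE.
Qed.

Lemma insens_cat_r (I J : finType) a (E : pred (word (option K) (I + J)%type)) u v :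
  insens a E -> E (wcat u (to a v)) = E (wcat u v).
Proof.
move=> Ea; rewrite -Ea -[RHS]Ea; congr (E _).
by apply/ffunP => -[c|c]; rewrite !ffunE.
Qed.

(** By [exists_spread] the set is dense on the points of some random subspace
    with letters in [K]; insensitivity lets the extra letter take all the values that
    [a] takes. *)
Lemma subspace_of_insens (J : finType) (a : K) (b : R) : 0 < b ->
  exists I : finType, forall E : pred (word (option K) I),
    insens a E -> b <= avg (fun w => (E w)%:R) ->
  exists V : space (option K) J I, nondeg V /\ forall x, E (inst V x).
Proof.
move=> b0; have b20 : 0 < b / 2 by rewrite divr_gt0.
have K'0 : (0 < #|{: option K}|)%N by rewrite card_option.
have [I0 [th [th0 HI0]]] := subspace_of_events K_gt0 dhj J b20.
have [I [Sm [V [Sm0 Vnd Vs]]]] := exists_spread K'0 I0 b20.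
exists I => E Ea bE.
pose B (w : word K I0) : pred Sm := fun o => E (inst (V o) (emb w)).
have [w|W [Wnd HW]] := HI0 Sm B.
  have := Vs (emb w) (fun z => (E z)%:R); rewrite ler_norml => /(_ _)/andP[].
    by move=> z; case: (E z); rewrite ?ler01 ?lexx.
  by rewrite /B; move: bE; lra.
have [ o Ho] := le_avg_exists Sm0 HW.
exists (compsp (V o) (liftsp W)); split; first exact/nondeg_comp/nondeg_lift.
move=> x; move: Ho; case: forallP => [Ho _|_ /=]; last by rewrite leNgt th0.
rewrite -Ea -to_inst Ea inst_comp /to inst_emb; exact: Ho.
Qed.

End Insensitive.

(** * Exhausting insensitive sets by subspaces *)

Section Exhaustion.
Variables (R : archiRealFieldType) (K : finType).
Hypothesis K_gt0 : (0 < #|K|)%N.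
Hypothesis dhj : DHJ R K.

Lemma sum_range_inst (J I : finType) (V : space (option K) J I)
    (g : word (option K) I -> R) : nondeg V ->
  \sum_x [exists u, x == inst V u]%:R * g x = \sum_u g (inst V u).
Proof.
move=> Vnd; pose D : {set word (option K) I} := [set inst V u | u in predT]%SET.
rewrite -(@big_imset _ _ _ _ _ _ predT g) /=; last by move=> u v _ _ /inst_inj; apply.
rewrite [RHS]big_mkcond; apply: eq_bigr => x _.
have -> : [exists u, x == inst V u] = (x \in D).
  apply/existsP/imsetP => [[u /eqP]|[u _ ->]]; first by exists u.
  by exists u.
by case: (x \in D); rewrite ?mul1r ?mul0r.
Qed.

(** As a value of [pick], the subspace depends on [E] only through the points
    of [E]. *)
Definition contains_space (J I : finType) (E : pred (word (option K) I)) :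
    option (space (option K) J I) :=
  [pick V : space (option K) J I |
    nondegb V && [forall x, E (inst V x)]].

Lemma contains_spaceP (J I : finType) (E : pred (word (option K) I)) :
  match contains_space J E with
  | Some V => nondeg V /\ forall x, E (inst V x)
  | None => forall V : space (option K) J I, nondeg V -> exists x, ~~ E (inst V x)
  end.
Proof.
rewrite /contains_space; case: pickP => [V /andP[/nondegP Vnd /forallP VE]|nV] //.
by move=> V /nondegP Vnd; have /negbT := nV V; rewrite Vnd negb_forall => /existsP.
Qed.

(** Up to density [b], the set [E] is a disjoint union of [J]-dimensional
    subspaces; this is expressed by duality with a function [h <= 1] that has
    nonpositive average on all of them. The coordinates come in blocks. As long as
    [E] has density more than [b], many of its fibres along the first block contain a
    subspace, and removing one from each of these fibres lowers the density by a fixed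
    amount [eta]. What remains is insensitive in the other blocks, because the
    subspace is chosen as a function of the fibre. The parameter set [Z] holds the
    blocks already treated. *)
Lemma exhaust_insens (J : finType) (a : K) (b : R) : 0 < b ->
  exists I : finType, forall (Z : finType) (E : Z -> pred (word (option K) I))
      (h : Z -> word (option K) I -> R),
    (forall z, insens a (E z)) -> (forall z w, h z w <= 1) ->
    (forall z (V : space (option K) J I), nondeg V ->
       avg (fun x => h z (inst V x)) <= 0) ->
  avg (fun z => avg (fun w => (E z w)%:R * h z w)) <= b.
Proof.
move=> b0; have b20 : 0 < b / 2 by rewrite divr_gt0.
have K'0 : (0 < #|{: option K}|)%N by rewrite card_option.
have [I1 HI1] := subspace_of_insens K_gt0 dhj J a b20.
have W1 := card_word_gt0 I1 K'0.
pose n1 : R := #|{: word (option K) I1}|%:R.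
have n10 : 0 < n1 by rewrite ltr0n.
pose eta := (b / 2) / n1.
have eta0 : 0 < eta by rewrite divr_gt0.
pose fix blocks (t : nat) : finType :=
  if t is t'.+1 then (I1 + blocks t')%type else void.
pose T := Num.bound (1 / eta).
have Teta : 1 <= T%:R * eta.
  rewrite -ler_pdivrMr //; apply/ltW/archi_boundP.
  by rewrite divr_ge0 ?ltW.
exists (blocks T) => Z E h Ea h1 hV.
have {Teta} : avg (fun z => avg (fun w => (E z w)%:R)) <= b + T%:R * eta.
  apply: (@le_trans _ _ 1); last by lra.
  by apply: avg_le1 => z; apply: avg_le1 => w; case: (E z w); rewrite ?ler01.
elim: {T} (T) Z E h Ea h1 hV => [|t IH] Z E h Ea h1 hV.
  rewrite mul0r addr0; apply: le_trans; apply: ler_avg => z; apply: ler_avg => w.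
  by case: (E z w); rewrite ?mul1r ?mul0r.
move=> HE.
have [Eb|bE] := lerP (avg (fun z => avg (fun w => (E z w)%:R))) b.
  apply: le_trans Eb; apply: ler_avg => z; apply: ler_avg => w.
  by case: (E z w); rewrite ?mul1r ?mul0r.
(* The words [x] range over the first block, the words [y] over the others. *)
pose fib z y : pred (word (option K) I1) := fun x => E z (wcat x y).
pose rem z y x := if contains_space J (fib z y) is Some V
  then [exists u, x == inst V u] else false.
have remE z x y : rem z y x -> E z (wcat x y).
  rewrite /rem; have := contains_spaceP J (fib z y).
  by case: contains_space => // V [_ VE] /existsP[u /eqP ->]; apply: VE.
pose E' (p : Z * word (option K) I1) y := E p.1 (wcat p.2 y) && ~~ rem p.1 y p.2.
pose h' (p : Z * word (option K) I1) y := h p.1 (wcat p.2 y).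
have splitE z x y (c : R) : (E z (wcat x y))%:R * c =
    (E' (z, x) y)%:R * c + (rem z y x)%:R * c.
  rewrite /E' /=; have := @remE z x y.
  case: (E z _); case: (rem z y x) => // h0; rewrite ?mul0r ?mul1r ?addr0 ?add0r //.
  by have := h0 isT.
have avgE (g : Z -> word (option K) (blocks t.+1) -> R) :
    avg (fun z => avg (fun w => (E z w)%:R * g z w)) =
    avg (fun p => avg (fun y => (E' p y)%:R * g p.1 (wcat p.2 y))) +
    avg (fun z => avg (fun y => avg (fun x => (rem z y x)%:R * g z (wcat x y)))).
  rewrite avg_pair -avgD; apply: eq_avg => z.
  rewrite avg_wcat /= [X in _ = _ + X]avg_exchange -avgD; apply: eq_avg => x.
  by rewrite -avgD; apply: eq_avg => y; rewrite splitE.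
have remh : avg (fun z => avg (fun y => avg (fun x =>
    (rem z y x)%:R * h z (wcat x y)))) <= 0.
  rewrite -oppr_ge0 -avgN; apply: avg_ge0 => z; rewrite -avgN; apply: avg_ge0 => y.
  rewrite oppr_ge0 /rem; have := contains_spaceP J (fib z y).
  case: contains_space => [V [Vnd _]|_]; last first.
    by rewrite (@eq_avg _ _ _ (fun=> 0)) ?avg_cst // => x; rewrite mul0r.
  rewrite /avg (sum_range_inst (fun x => h z (wcat x y)) Vnd).
  rewrite ler_pdivrMr ?ltr0n // mul0r.
  pose V' : space (option K) J (blocks t.+1) := [ffun c => match c with
    | inl c => V c | inr c => inl (y c) end].
  have V'nd : nondeg V'.
    by move=> j; have [c Vc] := Vnd j; exists (inl c); rewrite ffunE.
  have := hV z V' V'nd; rewrite /avg ler_pdivrMr ?ltr0n ?card_word_gt0 // mul0r.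
  apply: le_trans; apply: ler_sum => u _; rewrite le_eqVlt; apply/orP; left.
  by apply/eqP; congr (h z _); apply/ffunP => -[c|c]; rewrite !ffunE.
have rem_ge : eta <= avg (fun z => avg (fun y => avg (fun x => (rem z y x)%:R))).
  pose dense z y := b / 2 <= avg (fun x => (fib z y x)%:R).
  have d1 : b / 2 <= avg (fun z => avg (fun y => (dense z y)%:R)).
    suff : avg (fun z => avg (fun w => (E z w)%:R)) <=
        b / 2 + avg (fun z => avg (fun y => (dense z y)%:R)) by move: bE; lra.
    have Z0 : (0 < #|Z|)%N.
      by case: (posnP #|Z|) => // Z0; move: bE; rewrite /avg Z0 invr0 mulr0 ltNge ltW.
    rewrite -[X in _ <= X + _](avg_cst (b / 2) Z0) -avgD; apply: ler_avg => z.
    have W2 := card_word_gt0 (blocks t) K'0.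
    rewrite -[X in _ <= X + _](avg_cst (b / 2) W2) -avgD avg_wcat avg_exchange; apply: ler_avg => y.
    rewrite /dense -/(fib z y); case: (lerP (b / 2) (avg _)) => [_|]; last first.
      by rewrite /= addr0 => /ltW.
    apply: (@le_trans _ _ 1); last by rewrite /= lerDr ltW.
    by apply: avg_le1 => x; case: (E z _); rewrite ?ler01.
  rewrite /eta mulrC; apply: (@le_trans _ _ (n1^-1 *
      avg (fun z => avg (fun y => (dense z y)%:R)))).
    by rewrite ler_pM2l ?invr_gt0.
  rewrite -avgZ; apply: ler_avg => z; rewrite -avgZ; apply: ler_avg => y.
  rewrite /dense; case: (lerP (b / 2) (avg _)) => [dzy|_]; last by rewrite mulr0 avg_ge0.
  have [V [Vnd VE]] := HI1 (fib z y) (fun x => insens_cat x y (Ea z)) dzy.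
  rewrite mulr1 /rem; have := contains_spaceP J (fib z y).
  case: contains_space => [W [Wnd _]|/(_ V Vnd)[x]]; last by rewrite VE.
  have u0 : word (option K) J := [ffun=> None].
  rewrite /avg mulrC ler_peMr ?invr_ge0 // (bigD1 (inst W u0)) //=.
  have -> : [exists u, inst W u0 == inst W u] by apply/existsP; exists u0.
  by rewrite lerDl sumr_ge0.
rewrite avgE; apply: (@le_trans _ _ (b + 0)); last by rewrite addr0.
apply: lerD remh; apply: (IH _ E' h').
- move=> [z x] y; rewrite /E' /= (insens_cat_r _ _ (Ea z)); congr (_ && ~~ _).
  rewrite /rem /contains_space.
  rewrite (@eq_pick _ _ (fun V : space (option K) J I1 => nondegb V &&
    [forall u, fib z y (inst V u)])) // => V /=; congr (_ && _).
  by apply: eq_forallb => u; rewrite /fib (insens_cat_r _ _ (Ea z)).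
- by move=> [z x] y; apply: h1.
- move=> [z x] V Vnd; rewrite /h' /=.
  pose V' : space (option K) J (blocks t.+1) := [ffun c => match c with
    | inl c => inl (x c) | inr c => V c end].
  have V'nd : nondeg V'.
    by move=> j; have [c Vc] := Vnd j; exists (inr c); rewrite ffunE.
  apply: le_trans (hV z V' V'nd); apply: ler_avg => u; rewrite le_eqVlt.
  apply/orP; left; apply/eqP; congr (h z _).
  by apply/ffunP => -[c|c]; rewrite !ffunE.
have m1 (W : finType) (f : W -> R) : avg (fun w => f w * 1) = avg f.
  by apply: eq_avg => w; rewrite mulr1.
have := avgE (fun _ _ => 1).
under eq_avg do rewrite m1.
under [X in _ = X + _ -> _]eq_avg do rewrite m1.
under [X in _ = _ + X -> _]eq_avg do under eq_avg do rewrite m1.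
by move: HE rem_ge; rewrite -natr1 mulrDl mul1r; lra.
Qed.

(** Each letter is dealt with inside the large subspaces that exhaust the
    sets of the previous ones. *)
Lemma exhaust_insens_cap (s : seq K) (J : finType) (b : R) : 0 < b ->
  exists I : finType, forall (Z : finType)
      (E : K -> Z -> pred (word (option K) I)) (h : Z -> word (option K) I -> R),
    (forall a z, insens a (E a z)) -> (forall z w, h z w <= 1) ->
    (forall z (V : space (option K) J I), nondeg V ->
       avg (fun x => h z (inst V x)) <= 0) ->
  avg (fun z => avg (fun w => (all (fun a => E a z w) s)%:R * h z w)) <= b.
Proof.
have K'0 : (0 < #|{: option K}|)%N by rewrite card_option.
elim: s b => [|a s IH] b b0.
  exists J => Z E h _ _ hV.
  apply: (@le_trans _ _ 0); last by rewrite ltW.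
  rewrite -oppr_ge0 -avgN; apply: avg_ge0 => z; rewrite oppr_ge0.
  have id_nd : nondeg ([ffun c => inr c] : space (option K) J J).
    by move=> j; exists j; rewrite ffunE.
  apply: le_trans (hV z _ id_nd); apply: ler_avg => w; rewrite mul1r.
  rewrite le_eqVlt; apply/orP; left; apply/eqP; congr (h z _).
  by apply/ffunP => c; rewrite !ffunE.
have b20 : 0 < b / 2 by rewrite divr_gt0.
have [Is HIs] := IH _ b20.
have [I HI] := exhaust_insens Is a b20.
exists I => Z E h Ea h1 hV.
pose F z w := all (fun c => E c z w) s.
pose h' z w := (F z w)%:R * h z w - b / 2.
have [Z0|Z0] := posnP #|Z|; first by rewrite /avg Z0 invr0 mulr0 ltW.
have h'1 z w : h' z w <= 1.
  by rewrite /h'; have := h1 z w; case: (F z w); rewrite ?mul1r ?mul0r; lra.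
have h'V z (V : space (option K) Is I) : nondeg V -> avg (fun x => h' z (inst V x)) <= 0.
  move=> Vnd; rewrite avgB avg_cst ?card_word_gt0 // subr_le0.
  pose E1 c (_ : unit) x := E c z (inst V x).
  have E1a c u : insens c (E1 c u) by apply: insens_inst.
  have := HIs unit E1 (fun _ x => h z (inst V x)) E1a.
  rewrite avg_unit; apply=> [_ x|_ W Wnd]; first exact: h1.
  have := hV z _ (nondeg_comp Vnd Wnd); apply: le_trans; rewrite le_eqVlt.
  by apply/orP; left; apply/eqP/eq_avg => x; rewrite inst_comp.
rewrite [b]splitr -{2}(avg_cst (b / 2) Z0).
apply: le_trans (lerD (HI Z (E a) h' (Ea a) h'1 h'V) (lexx _)).
rewrite -avgD; apply: ler_avg => z.
rewrite -[X in _ <= _ + X](avg_cst (b / 2) (card_word_gt0 I K'0)) -avgD; apply: ler_avg => w.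
rewrite /= /h' -/(F z w); case: (E a z w); rewrite ?mul1r ?mul0r; lra.
Qed.

End Exhaustion.

(** * The density Hales-Jewett theorem *)

Section DensityIncrement.
Variables (R : archiRealFieldType) (K : finType).
Hypothesis K_gt0 : (0 < #|K|)%N.

Let K'_gt0 : (0 < #|{: option K}|)%N.
Proof. by rewrite card_option. Qed.

(** The lines over [K] met in a random subspace [U] of dimension set [D] look
    like uniformly random words over [option K], up to a further random subspace [W].

    [U] is built by levels, each parameter corresponding to one level. A level
    is a random word over [option K], much longer than the previous ones, whose extra
    letters form the wild set of the new parameter, and in which the previous
    levels overwrite a few letters without affecting the law. If the line [L] has
    its highest wild parameter at a given level, then the word of this level, with all
    lower ones inside, is almost uniform, whatever the rest of [L]; the higher levels
    have constants of [K] in place of their wild sets, and form [W].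

    Every level starts with a wild coordinate, so that all points of [W] contain
    the extra letter, and includes a copy of [I0]. *)
Lemma line_levels (D I0 : finType) (e : R) : 0 < e ->
  exists (I Sm : finType) (U : Sm -> space K D I), (0 < #|Sm|)%N /\
  forall L : word (option K) D, proper_line L ->
  exists (X Sm' : finType) (W : Sm' -> space (option K) (I0 + X)%type I),
    [/\ (0 < #|Sm'|)%N, forall o, nondeg (W o), forall o, exists c, W o c = inl None &
     forall f : word (option K) I -> R, (forall w, 0 <= f w <= 1) ->
      `|avg (fun o => f (inst (liftsp (U o)) L)) -
        avg (fun o => avg (fun l => f (inst (W o) l)))| <= e].
Proof.
move=> e0; elim/finType_ind: D => [|D IH|D D' e1 be IH].
- exists void, unit, (fun=> [ffun c => of_void _ c]); split; first by rewrite card_unit.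
  by move=> L /existsP[[]].
- have [I' [Sm' [U' [Sm'0 HU']]]] := IH.
  have [X0 [SmR [V [SmR0 Vnd Vs]]]] := exists_spread K'_gt0 I' e0.
  (* [P] is the word of the new level with the lower levels left free. *)
  pose Bg := (word (option K) I0 * SmR)%type.
  have Bg0 : (0 < #|{: Bg}|)%N by rewrite card_prod muln_gt0 card_word_gt0.
  pose P (p : Bg) : space (option K) I' (unit + (I0 + X0))%type :=
    [ffun c => match c with
     | inl tt => inl None
     | inr (inl c) => inl (p.1 c)
     | inr (inr c) => V p.2 c end].
  (* [None] now denotes a letter of the new level; it becomes its parameter. *)
  pose U (p : Bg * Sm') : space K (unit + D)%type (unit + (I0 + X0))%type :=
    [ffun c => match P p.1 c with
     | inl None => inr (inl tt)
     | inl (Some a) => inl a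
     | inr c => match U' p.2 c with inl a => inl a | inr d => inr (inr d) end end].
  exists (unit + (I0 + X0))%type, (Bg * Sm')%type, U.
  split=> [|L pL]; first by rewrite card_prod muln_gt0 Bg0.
  pose L' : word (option K) D := [ffun d => L (inr d)].
  case Ltt: (L (inl tt)) => [a|].
  (* The top parameter is constant: its level is absorbed into [W]. *)
  + have pL' : proper_line L'.
      case/existsP: pL => -[[]|d] /eqP Ld; first by rewrite Ltt in Ld.
      by apply/existsP; exists d; rewrite ffunE Ld.
    have [X [SmW [W [SmW0 Wnd WN HW]]]] := HU' _ pL'.
    pose Pa (p : Bg) : space K I' (unit + (I0 + X0))%type :=
      [ffun c => match P p c with inl v => inl (odflt a v) | inr c => inr c end].
    have Pand p : nondeg (Pa p).
      by move=> c; have [c' Vc] := Vnd p.2 c; exists (inr (inr c')); rewrite !ffunE Vc.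
    exists X, (Bg * SmW)%type, (fun p => compsp (liftsp (Pa p.1)) (W p.2)); split.
    * by rewrite card_prod muln_gt0 Bg0.
    * by move=> o; apply: nondeg_comp => //; apply: nondeg_lift.
    * move=> o; have [c Wc] := WN o.2; have [c' Pc'] := Pand o.1 c.
      by exists c'; rewrite !ffunE in Pc' *; rewrite Pc' Wc.
    move=> f f01; rewrite avg_pair [X in _ - X]avg_pair.
    apply: ler_dist_avg => [|p]; first exact: ltW.
    have := HW (fun w => f (inst (liftsp (Pa p)) w)) (fun w => f01 _).
    apply: le_trans; rewrite le_eqVlt; apply/orP; left; apply/eqP; congr `|_ - _|.
      apply: eq_avg => u; congr (f _); apply/ffunP => c; rewrite !ffunE /=.
      case: c => [[]|[c|c]] //=; first by case: (p.1 c).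
      by case: (V p.2 c) => [[b|]|c'] //; rewrite !ffunE; case: (U' u c') => // d; rewrite ffunE.
    by apply: eq_avg => w; apply: eq_avg => l; rewrite inst_comp.
  (* The top parameter is wild: the word of this level is almost uniform. *)
  pose W : space (option K) (I0 + X0)%type (unit + (I0 + X0))%type :=
    [ffun c => match c with inl _ => inl None | inr c => inr c end].
  exists X0, unit, (fun=> W); split; first by rewrite card_unit.
  + by move=> _ c; exists (inr c); rewrite ffunE.
  + by move=> _; exists (inl tt); rewrite ffunE.
  move=> f f01; rewrite avg_unit avg_wcat !avg_pair.
  apply: ler_dist_avg => [|y]; first exact: ltW.
  rewrite avg_exchange [X in _ - X](avg_wide _ Sm'0); apply: ler_dist_avg => [|u]; first exact: ltW.
  have := Vs (inst (liftsp (U' u)) L') (fun v => f (inst W (wcat y v))) (fun v => f01 _).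
  apply: le_trans; rewrite le_eqVlt; apply/orP; left; apply/eqP; congr `|_ - _|.
  apply: eq_avg => o; congr (f _); apply/ffunP => c; rewrite !ffunE /=.
  case: c => [[]|[c|c]] //=; rewrite !ffunE; first by case: (y c).
  case: (V o c) => [[b|]|c'] //=; rewrite !ffunE.
  by case: (U' u c') => // d; rewrite ffunE.
- have [I [Sm [U [Sm0 HU]]]] := IH.
  exists I, Sm, (fun o => [ffun c => match U o c with inl a => inl a | inr d => inr (e1 d) end]).
  split=> // L pL; pose L1 : word (option K) D := [ffun d => L (e1 d)].
  have [|X [Sm' [W [Sm1_gt0 Wnd WN HW]]]] := HU L1.
    have [e2 e1K e2K] := be; have /existsP[d Ld] := pL.
    by apply/existsP; exists (e2 d); rewrite ffunE e2K.
  exists X, Sm', W; split=> // f f01; apply: le_trans (HW f f01).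
  rewrite le_eqVlt; apply/orP; left; apply/eqP; congr `|_ - _|; apply: eq_avg => o.
  congr (f _); apply/ffunP => c; rewrite !ffunE.
  by case: (U o c) => // d; rewrite ffunE.
Qed.

Hypothesis dhj : DHJ R K.

(** The complement of the intersection of the [D a] splits, according to the
    first letter whose set is left, into intersections of insensitive sets. Each of
    them is exhausted by subspaces, on which [A] has density at most [t], with an
    error [b]. *)
Lemma increment_of_insens (J : finType) (b : R) : 0 < b ->
  exists I : finType, forall (Z : finType) (A : Z -> pred (word (option K) I))
    (D : K -> Z -> pred (word (option K) I)) (t : R),
  (0 < #|Z|)%N -> 0 <= t ->
  (forall a z, insens a (D a z)) ->
  (forall z w, A z w -> ~~ [forall a, D a z w]) ->
  (forall z (V : space (option K) J I), nondeg V ->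
     avg (fun x => (A z (inst V x))%:R) <= t) ->
  avg (fun z => avg (fun w => (A z w)%:R)) <=
  t * (1 - avg (fun z => avg (fun w => [forall a, D a z w]%:R))) + #|K|%:R * b.
Proof.
move=> b0; have [I HI] := exhaust_insens_cap K_gt0 dhj (enum K) J b0.
exists I => Z A D t Z0 t0 Da AD At.
pose h z w : R := (A z w)%:R - t.
have h1 z w : h z w <= 1 by rewrite /h; case: (A z w) => /=; lra.
have hV z (V : space (option K) J I) : nondeg V -> avg (fun x => h z (inst V x)) <= 0.
  by move=> Vnd; rewrite avgB avg_cst ?card_word_gt0 // subr_le0 At.
have Hr (r : seq K) :
    avg (fun z => avg (fun w => (~~ all (fun a => D a z w) r)%:R * h z w)) <=
    (size r)%:R * b.
  elim: r => [|a r IH].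
    rewrite mul0r (@eq_avg _ _ _ (fun=> 0)) ?avg_cst // => z.
    by rewrite (@eq_avg _ _ _ (fun=> 0)) ?avg_cst ?card_word_gt0 // => w; rewrite mul0r.
  (* Words that are in the sets of all letters of [r] but not in that of [a]. *)
  pose E c z w := ((c \in r) ==> D c z w) && ((c == a) ==> ~~ D c z w).
  have Ea c z : insens c (E c z) by move=> w; rewrite /E Da.
  rewrite /= -natr1 mulrDl mul1r.
  apply: le_trans (lerD IH (HI Z E h Ea h1 hV)).
  rewrite -avgD; apply: ler_avg => z; rewrite -avgD; apply: ler_avg => w.
  rewrite -mulrDl -natrD.
  have -> : all (fun c => E c z w) (enum K) = all (fun c => D c z w) r && ~~ D a z w.
    apply/allP/andP => [HE|[/allP Dr Da'] c _].
      have HE' c : E c z w by apply: HE; rewrite mem_enum.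
      split; last by have /andP[_] := HE' a; rewrite eqxx.
      by apply/allP => c cr; have /andP[] := HE' c; rewrite cr.
    apply/andP; split; first by apply/implyP => /Dr.
    by apply/implyP => /eqP ->.
  by rewrite negb_and; case: (D a z w); case: (all _ r).
have := Hr (enum K); rewrite -cardE.
pose N z w := [forall a, D a z w].
rewrite (@eq_avg _ _ _ (fun z =>
  (avg (fun w => (A z w)%:R) - t) + t * avg (fun w => (N z w)%:R))); last first.
  move=> z; rewrite -avgZ -(avg_cst t (card_word_gt0 I K'_gt0)) -avgB -avgD.
  rewrite avg_cst ?card_word_gt0 //; apply: eq_avg => w.
  have -> : all (fun a => D a z w) (enum K) = N z w.
    by apply/allP/forallP => [Dall a|Dall a _]; rewrite ?Dall ?mem_enum.
  rewrite /h; case: (boolP (A z w)) => [/AD/negPf|_]; rewrite -/(N z w).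
    by move=> ->; rewrite mul1r mulr0 addr0.
  by case: (N z w) => /=; ring.
rewrite avgD avgZ avgB (avg_cst t Z0); lra.
Qed.

(** The points of the line whose wild coordinates are those of the extra letter
    in [y] are [y] itself and the words [to a y]. *)
Lemma linefree_to (I : finType) (A : pred (word (option K) I))
    (y : word (option K) I) :
  linefree A -> (exists c, y c = None) -> A y -> ~~ [forall a, A (to a y)].
Proof.
move=> Alf [c yc] Ay.
pose l : word (option (option K)) I := [ffun c => omap Some (y c)].
have pl : proper_line l by apply/existsP; exists c; rewrite ffunE yc.
have [[a|] Aa] := Alf _ pl.
  rewrite negb_forall; apply/existsP; exists a; apply: contra Aa.
  by congr (is_true (A _)); apply/ffunP => i; rewrite !ffunE; case: (y i).
case/negP: Aa; move: Ay; congr (is_true (A _)).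
by apply/ffunP => i; rewrite !ffunE; case: (y i).
Qed.

(** Density [d] does not force lines, in any dimension. *)
Definition dense_linefree (L : finType) (d : R) := forall J : finType,
  exists A : pred (word L J), linefree A /\ d <= avg (fun w => (A w)%:R).

(** With [t = d + g] in [increment_of_insens], the set [A], of density at least
    [d - e], and the intersection of the insensitive sets, of density at least
    [th - e], would satisfy [d - e <= (d + g) * (1 - (th - e)) + k * b]; the constants
    are chosen so that this fails. *)
Lemma density_increment (d0 : R) : 0 < d0 -> exists g : R, 0 < g /\
  forall d, d0 <= d -> dense_linefree (option K) d ->
    dense_linefree (option K) (d + g).
Proof.
move=> d00; have d020 : 0 < d0 / 2 by rewrite divr_gt0.
have [D [th [th0 HD]]] := line_of_events K_gt0 dhj d020.
pose k : R := #|K|%:R; have k0 : 0 < k by rewrite ltr0n.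
pose g := d0 * th / 8; have g0 : 0 < g by rewrite divr_gt0 ?mulr_gt0.
pose b := g / k; have b0 : 0 < b by rewrite divr_gt0.
pose e := Num.min (th / 2) (Num.min (d0 / 2) g).
have e0 : 0 < e by rewrite !lt_min g0 !divr_gt0.
have e1 : e <= th / 2 by rewrite ge_min lexx.
have e2 : e <= d0 / 2 by rewrite !ge_min lexx orbT.
have e3 : e <= g by rewrite !ge_min lexx !orbT.
exists g; split=> // d dd0 bad_d J.
have [I0 HI0] := increment_of_insens J b0.
have [I [Sm [U [Sm0 HU]]]] := line_levels D I0 e0.
have [Jb [SmS [V [SmS0 Vnd Vs]]]] := exists_spread K'_gt0 I e0.
have [A [Alf dA]] := bad_d Jb.
have A01 (w : word (option K) Jb) : 0 <= ((A w)%:R : R) <= 1.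
  by case: (A w); rewrite ?ler01 ?lexx.
have VA x : d - e <= avg (fun s => (A (inst (V s) x))%:R).
  have := Vs x _ A01; rewrite ler_norml => /andP[]; move: dA; lra.
pose B (w : word K D) : pred (SmS * Sm) :=
  fun p => A (inst (V p.1) (emb (inst (U p.2) w))).
have [w|L [pL HL]] := HD _ B.
  apply: (@le_trans _ _ (d - e)); first by move: e2 dd0; lra.
  rewrite avg_pair avg_exchange -(avg_cst (d - e) Sm0); apply: ler_avg => u.
  exact: (VA (emb (inst (U u) w))).
have [X [SmW [W [SmW0 Wnd WN HW]]]] := HU _ pL.
pose Z := ((SmS * SmW) * word (option K) X)%type.
(* The line-free set and the insensitive sets seen in the random subspace
   [inst (V z.1.1) \o inst (W z.1.2)], whose coordinates outside [I0] are fixed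
   to [z.2]. *)
pose As (z : Z) (u : word (option K) I0) :=
  A (inst (V z.1.1) (inst (W z.1.2) (wcat u z.2))).
pose Ds (a : K) (z : Z) (u : word (option K) I0) :=
  A (inst (V z.1.1) (to a (inst (W z.1.2) (wcat u z.2)))).
have Z0 : (0 < #|{: Z}|)%N by rewrite !card_prod !muln_gt0 SmS0 SmW0 card_word_gt0.
have avgZ (F : SmS -> SmW -> word (option K) (I0 + X)%type -> R) :
    avg (fun z : Z => avg (fun u => F z.1.1 z.1.2 (wcat u z.2))) =
    avg (fun s => avg (fun w => avg (F s w))).
  rewrite !avg_pair; apply: eq_avg => s; apply: eq_avg => w.
  by rewrite avg_wcat avg_exchange.
have [/existsP[[z V'] /andP[/nondegP V'nd]]|nV'] := boolP
  [exists p : Z * space (option K) J I0, nondegb p.2 &&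
     (d + g <= avg (fun x => (As p.1 (inst p.2 x))%:R))].
  rewrite /= => HV'; exists (fun x => As z (inst V' x)); split=> //.
  pose Vz : space (option K) J (I0 + X)%type :=
    [ffun c => match c with inl c => V' c | inr c => inl (z.2 c) end].
  have Vznd : nondeg Vz.
    by move=> j; have [c Vc] := V'nd j; exists (inl c); rewrite ffunE.
  have lf := linefree_inst (nondeg_comp (nondeg_comp (Vnd z.1.1) (Wnd z.1.2)) Vznd) Alf.
  move=> l pl; have [a] := lf l pl; exists a.
  rewrite /As -inst_comp (_ : wcat _ _ = inst Vz (fill l a)) -?inst_comp //.
  by apply/ffunP => -[c|c]; rewrite !ffunE.
exfalso.
have HZ : avg (fun z => avg (fun u => (As z u)%:R)) <=
    (d + g) * (1 - avg (fun z => avg (fun u => [forall a, Ds a z u]%:R))) + k * b.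
  apply: HI0 => //.
  - by rewrite addr_ge0 ?ltW // (lt_le_trans d00).
  - move=> a z u; rewrite /Ds; congr (A (inst _ _)).
    by apply/ffunP => c; rewrite !ffunE; case: (W _ c) => // -[j|j]; rewrite !ffunE.
  - move=> z u; rewrite /As /Ds => Azu.
    apply: (linefree_to (linefree_inst (Vnd z.1.1) Alf)) => //.
    by have [c Wc] := WN z.1.2; exists c; rewrite ffunE Wc.
  - move=> z V' V'nd; move: nV'; rewrite negb_exists => /forallP/(_ (z, V')).
    by rewrite negb_and /= -ltNge => /orP[/negP[]|/ltW //]; apply/nondegP.
have H1 : d - e <= avg (fun z => avg (fun u => (As z u)%:R)).
  rewrite (avgZ (fun s w x => (A (inst (V s) (inst (W w) x)))%:R)).
  rewrite avg_exchange -(avg_cst (d - e) SmW0); apply: ler_avg => w.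
  rewrite avg_exchange -(avg_cst (d - e) (card_word_gt0 (I0 + X)%type K'_gt0)).
  by apply: ler_avg => x.
have H2 : th - e <= avg (fun z => avg (fun u => [forall a, Ds a z u]%:R)).
  rewrite (avgZ (fun s w x =>
    [forall a, A (inst (V s) (to a (inst (W w) x)))]%:R)).
  rewrite lerBlDr; apply: le_trans HL _; rewrite avg_pair.
  rewrite -[X in _ <= _ + X](avg_cst e SmS0) -avgD; apply: ler_avg => s.
  have := HW (fun l => [forall a, A (inst (V s) (to a l))]%:R) _.
  rewrite ler_norml => /(_ _)/andP[w|_]; first by case: [forall a, _]; rewrite ?ler01 ?lexx.
  rewrite lerBlDr addrC; apply: le_trans; rewrite le_eqVlt; apply/orP; left; apply/eqP.
  apply: eq_avg => u; congr (_%:R); congr nat_of_bool.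
  by apply: eq_forallb => a; rewrite /B /to fill_inst.
have kb : k * b = g by rewrite /b mulrC divfK ?gt_eqF.
set D1 := avg (fun z => avg (fun u => [forall a, Ds a z u]%:R)) in HZ H2.
have H3 : d0 * (th - e) <= (d + g) * D1.
  apply: ler_pM => //; last by lra.
  - exact: ltW.
  - lra.
have H4 : d0 * (th / 2) <= d0 * (th - e) by rewrite ler_pM2l //; lra.
have H5 : d0 * (th / 2) = 4 * g by rewrite /g; field.
move: HZ; rewrite mulrBr mulr1 kb; lra.
Qed.

End DensityIncrement.

Lemma avg_pred_le1 (R : archiRealFieldType) (W : finType) (A : pred W) :
  avg (fun w => (A w)%:R) <= 1 :> R.
Proof. by apply: avg_le1 => w; case: (A w); rewrite ?ler01. Qed.

(** A density that does not force lines could be raised by [g] any number of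
    times. *)
Theorem DHJ_option (R : archiRealFieldType) (K : finType) :
  (0 < #|K|)%N -> DHJ R K -> DHJ R (option K).
Proof.
move=> K0 dhj d0 d00; apply: boolp.contrapT => nd.
have [g [g0 Hg]] := density_increment K0 dhj d00.
have bad n : dense_linefree (option K) (d0 + n%:R * g).
  elim: n => [|n IH].
    move=> J; rewrite mul0r addr0; apply: boolp.contrapT => nA; apply: nd.
    exists J => A Alf; rewrite ltNge; apply/negP => dA; apply: nA.
    by exists A.
  rewrite -natr1 mulrDl mul1r addrA; apply: Hg IH.
  by rewrite lerDl mulr_ge0 // ltW.
have /archi_boundP : 0 <= g^-1 by rewrite invr_ge0 ltW.
set n := Num.Def.archi_bound _ => gn.
have [A [_]] := bad n void; apply/negP; rewrite -ltNge.
apply: (le_lt_trans (avg_pred_le1 R A)); apply: (@lt_le_trans _ _ (n%:R * g)).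
  by rewrite -ltr_pdivrMr // div1r.
by rewrite lerDr ltW.
Qed.

Fixpoint alphabet (l : nat) : finType :=
  if l is l'.+1 then option (alphabet l') else unit.

Theorem density_Hales_Jewett (R : archiRealFieldType) (l : nat) : DHJ R (alphabet l).
Proof.
elim: l => [|l IH]; last first.
  by apply: DHJ_option IH; case: l => [|l]; rewrite ?card_unit ?card_option.
move=> d d0; exists unit => A Alf.
rewrite (@eq_avg _ _ _ (fun=> 0)) => [|w]; first by rewrite avg_cst ?card_word_gt0 ?card_unit.
have [|a] := Alf [ffun=> None]; first by apply/existsP; exists tt; rewrite ffunE.
rewrite (_ : fill _ _ = w) => [/negPf -> //|].
by apply/ffunP => c; rewrite !ffunE; case: a; case: (w c).
Qed.

(** * Recurrence along finite product sets *)

Section MeasurableEvents.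
Variables (R : realType) (d : measure_display) (X : measurableType d).
Variable mu : probability X R.

Lemma integral_sum_indic (J : finType) (P : pred J) (S : J -> set X) (c : R) :
  0 <= c -> (forall j, measurable (S j)) ->
  (\int[mu]_x (\sum_(j | P j) c * \1_(S j) x)%:E =
   \sum_(j | P j) c%:E * mu (S j))%E.
Proof.
move=> c0 mS; rewrite big_mkcond /=.
under eq_integral do rewrite big_mkcond /= -sumEFin.
rewrite ge0_integral_sum //.
- apply: eq_bigr => j _; case: (P j); last by rewrite integral0.
  under eq_integral do rewrite EFinM.
  rewrite ge0_integralZl_EFin //; last by apply/measurable_EFinP; exact: measurable_indic.
  by rewrite integral_indic // setIT.
- move=> j; case: (P j) => //.
  apply/measurable_EFinP; apply: measurable_funM => //; exact: measurable_indic.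
- by move=> j x _; case: (P j); rewrite lee_fin ?mulr_ge0.
Qed.

(** [density_le_lines] is integrated as in [line_of_events]. *)
Lemma line_of_measurable_events (K : finType) (e : R) :
  (0 < #|K|)%N -> DHJ R K -> 0 < e ->
  exists (I : finType) (th : R), 0 < th /\
  forall B : word K I -> set X, (forall w, measurable (B w)) ->
    (forall w, (e%:E <= mu (B w))%E) ->
  exists l, proper_line l /\
    (th%:E <= mu (\bigcap_(a in [set: K]) B (fill l a)))%E.
Proof.
move=> K0 dhj e0; have e20 : 0 < e / 2 by rewrite divr_gt0.
have [I HI] := density_le_lines dhj e20.
pose m : R := #|{: word (option K) I}|%:R.
have m0 : 0 < m by rewrite ltr0n card_word_gt0 // card_option.
pose th := (e / 4) / m; have th0 : 0 < th by rewrite !divr_gt0.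
exists I, th; split=> // B mB eB.
pose C l := \bigcap_(a in [set: K]) B (fill l a).
have mC l : measurable (C l).
  by apply: fin_bigcap_measurable => //; exact: finite_finset.
apply: contrapT => nl.
have Cth l : proper_line l -> (mu (C l) <= th%:E)%E.
  by move=> pl; rewrite leNgt; apply/negP => /ltW h; apply: nl; exists l.
pose n : R := #|{: word K I}|%:R.
have n0 : 0 < n by rewrite ltr0n card_word_gt0.
have key : (\int[mu]_x (\sum_(w : word K I) n^-1 * \1_(B w) x)%:E <=
    \int[mu]_x ((e / 2)%:E + (\sum_(l | proper_line l) 1 * \1_(C l) x)%:E))%E.
  apply: ge0_le_integral => //.
  - by move=> x _; rewrite lee_fin sumr_ge0 // => w _; rewrite mulr_ge0 // invr_ge0 ltW.
  - apply/measurable_EFinP; apply: measurable_sum => w.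
    by apply: measurable_funM => //; exact: measurable_indic.
  - apply: emeasurable_funD => //; apply/measurable_EFinP.
    under eq_fun do rewrite big_mkcond /=.
    apply: measurable_sum => l; case: (proper_line l) => //.
    by apply: measurable_funM => //; exact: measurable_indic.
  move=> x _; rewrite -EFinD lee_fin.
  have := HI (fun w => `[< B w x >]); rewrite /avg mulrC mulr_sumr.
  rewrite (eq_bigr (fun w => n^-1 * \1_(B w) x)); last first.
    by move=> w _; rewrite indicE.
  move=> /le_trans; apply; rewrite lerD2l /lines_in; apply: ler_sum => l _.
  rewrite mul1r indicE ler_nat; case: forallP => // Bl.
  by rewrite lt0b inE => a _; apply/asboolP/Bl.
move: key; rewrite integral_sum_indic ?invr_ge0 ?(ltW n0) //.
rewrite ge0_integralD //; last 3 first.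
- by move=> x _; rewrite lee_fin ltW.
- by move=> x _; rewrite lee_fin sumr_ge0 // => l _; rewrite mul1r.
- apply/measurable_EFinP; under eq_fun do rewrite big_mkcond /=.
  apply: measurable_sum => l; case: (proper_line l) => //.
  by apply: measurable_funM => //; exact: measurable_indic.
rewrite integral_sum_indic // integral_cst //.
set m1 := (X in (_ * X + _)%E); have -> : m1 = 1%E by exact: probability_setT.
rewrite mule1.
apply/negP; rewrite -ltNge; apply: (@lt_le_trans _ _ e%:E).
  apply: (@le_lt_trans _ _ ((e / 2)%:E + (e / 4)%:E)%E); last first.
    by rewrite -EFinD lte_fin; lra.
  rewrite leeD2lE //.
  have -> : (e / 4)%:E = (\sum_(l : word (option K) I) th%:E)%E.
    rewrite sumEFin sumr_const -[_ *+ #|_|]mulr_natr /th divfK // gt_eqF //.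
  rewrite big_mkcond /=; apply: lee_sum => l _.
  by case: ifPn => [/Cth|_]; rewrite ?mul1e // lee_fin ltW.
have -> : e%:E = (\sum_(w : word K I) (n^-1)%:E * e%:E)%E.
  rewrite -EFinM sumEFin sumr_const -[_ *+ #|_|]mulr_natr mulrAC mulVf ?mul1r //.
  by rewrite gt_eqF.
by apply: lee_sum => w _; rewrite lee_pmul2l // lte_fin invr_gt0.
Qed.

End MeasurableEvents.

Fixpoint letter_val (l : nat) : alphabet l -> nat :=
  match l return alphabet l -> nat with
  | 0 => fun _ => 0%N
  | l'.+1 => fun o => if o is Some a then letter_val a else l'.+1
  end.

Lemma letter_val_surj l j : (j <= l)%N -> exists a : alphabet l, letter_val a = j.
Proof.
elim: l j => [|l IH] j; first by rewrite leqn0 => /eqP ->; exists tt.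
rewrite leq_eqVlt => /orP[/eqP ->|]; first by exists None.
by rewrite ltnS => /IH[a <-]; exists (Some a).
Qed.

Lemma alphabet_gt0 l : (0 < #|alphabet l|)%N.
Proof. by case: l => [|l]; rewrite ?card_unit ?card_option. Qed.

Section Recurrence.
Variables (R : realType) (d : measure_display) (X : measurableType d).
Variables (mu : probability X R) (T : posnat -> X -> X).
Hypothesis HT : mul_system mu T.
Variable A : set X.
Hypotheses (mA : measurable A) (muA : (0 < mu A)%E).

Definition return_set (ell : nat) (m : posnat) : set X :=
  A `&` \bigcap_(j in [set j | (1 <= j <= ell)%N]) (T (posnat_exp m j) @^-1` A).

Lemma measurable_T_preimage m B : measurable B -> measurable (T m @^-1` B).
Proof. by move=> mB; rewrite -[_ @^-1` _]setTI; apply: (HT.1 m).1. Qed.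

Lemma measurable_return_set ell m : measurable (return_set ell m).
Proof.
apply: measurableI => //; apply: bigcap_measurableType => j _.
exact: measurable_T_preimage.
Qed.

(** The letters of a word are read as exponents of the [q i]. A line with wild
    set [S] then runs through [g0 * m ^ j] for [j = 0, ..., ell], where [g0] comes from
    the constant letters, and the events along it intersect in the preimage under
    [T g0] of the return set of [m]. The event at [j = 0] is the
    preimage of [A] under [T g0], which does not require [T 1] to be the identity. *)
Lemma IP_recurrence (ell : nat) : exists (I : finType) (th : R), 0 < th /\
  forall q : I -> posnat, exists (S : pred I) (m : posnat),
    [/\ exists i, S i, m = (\prod_(i | S i) q i)%N :> nat &
        (th%:E <= mu (return_set ell m))%E].
Proof.
have e0 : 0 < fine (mu A) by rewrite fine_gt0 // muA ltey_eq fin_num_measure.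
have [I [th [th0 HI]]] := line_of_measurable_events mu (alphabet_gt0 ell)
  (@density_Hales_Jewett R ell) e0.
exists I, th; split=> // q.
have pos (w : word (alphabet ell) I) : (0 < \prod_i q i ^ letter_val (w i))%N.
  by apply: prodn_gt0 => i; rewrite expn_gt0 posnat_gt0.
pose g w := Posnat (pos w).
have mB w : measurable (T (g w) @^-1` A) by apply: measurable_T_preimage.
have [w|l [/existsP[c lc] Hl]] := HI _ mB.
  by rewrite (HT.1 (g w)).2 // fineK // fin_num_measure.
pose S := [pred i | l i == None].
have mpos : (0 < \prod_(i | S i) q i)%N by apply: prodn_gt0 => i; rewrite posnat_gt0.
have [a0 va0] := letter_val_surj (leq0n ell).
have gpos : (0 < \prod_(i | ~~ S i) q i ^ letter_val (odflt a0 (l i)))%N.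
  by apply: prodn_gt0 => i; rewrite expn_gt0 posnat_gt0.
exists S, (Posnat mpos); split=> //; first by exists c.
apply: le_trans Hl _; rewrite -[leRHS]((HT.1 (Posnat gpos)).2); last first.
  exact: measurable_return_set.
have gE a : g (fill l a) = posnat_mul (posnat_exp (Posnat mpos) (letter_val a)) (Posnat gpos).
  apply: val_inj => /=; rewrite (bigID S) /= unstable.expn_prod; congr (_ * _)%N.
    by apply: eq_bigr => i /eqP li; rewrite ffunE li.
  by apply: eq_bigr => i; rewrite ffunE; case: (l i).
apply: le_measure; rewrite ?inE.
- by apply: fin_bigcap_measurable => //; exact: finite_finset.
- exact/measurable_T_preimage/measurable_return_set.
move=> x Bx; have {}Bx a : A (T (g (fill l a)) x) by exact: Bx.
split=> [|j /= /andP[_ /letter_val_surj[a va]]].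
  have := Bx a0; congr (A (T _ x)); rewrite gE; apply: val_inj => /=.
  by rewrite va0 expn0 mul1n.
by have := Bx a; rewrite /= gE HT.2 va.
Qed.

End Recurrence.

(** * Syndeticity *)

Section Syndetic.
Variables (S : eqType) (op : S -> S -> S).

Fixpoint subproducts (s : seq S) : seq S :=
  if s is x :: s' then x :: subproducts s' ++ [seq op x y | y <- subproducts s']
  else [::].

Lemma subproductsP (f : S -> posnat) (x0 : S) (s : seq S) (p : pred nat) :
  (forall x y, f (op x y) = (f x * f y)%N :> nat) ->
  (exists2 i, (i < size s)%N & p i) ->
  exists2 y, y \in subproducts s &
    f y = (\prod_(i < size s | p i) f (nth x0 s i))%N :> nat.
Proof.
move=> fop; elim: s p => [|x s IH] p [i] //=; rewrite big_mkcond big_ord_recl -big_mkcond /=.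
set P := (\prod_(_ | _) _)%N.
have [[j js pj]|nex] := pselect (exists2 j, (j < size s)%N & p j.+1) => is_ pi.
  have [y ys fy] := IH (fun j => p j.+1) (ex_intro2 _ _ j js pj).
  case: ifP => p0.
    exists (op x y); last by rewrite fop fy.
    by rewrite inE mem_cat map_f ?orbT.
  by exists y; rewrite ?mul1n // inE mem_cat ys orbT.
exists x; first by rewrite inE eqxx.
rewrite /P big_pred0 ?muln1 => [|j]; last first.
  by apply/negP => pj; apply: nex; exists j.
case: i is_ pi => [|i] is_ pi; first by rewrite pi.
by case: nex; exists i.
Qed.

(** If no finite set of translates worked, a sequence could be chosen one term
    at a time, each new term avoiding [G] together with its products with all
    the earlier subproducts. *)
Lemma syndetic_of_IP (G : S -> Prop) (m : nat) (b0 : S) : associative op ->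
  (forall s, size s = m -> exists2 y, y \in subproducts s & G y) ->
  exists F : seq S, forall x, exists2 b, b \in F & G (op x b).
Proof.
move=> opA Gm; apply: contrapT => nF.
have avoid (F : seq S) : exists x, forall b, b \in F -> ~ G (op x b).
  apply: contrapT => nx; apply: nF; exists F => x; apply: contrapT => nb.
  by apply: nx; exists x => b bF Gb; apply: nb; exists b.
have [s [sm sG]] : exists s, size s = m /\ forall y, y \in subproducts s -> ~ G y.
  elim: (m) => [|n [s [sn sG]]]; first by exists [::].
  have [x xG] := avoid (b0 :: [seq op b0 y | y <- subproducts s]).
  exists (op x b0 :: s); split; first by rewrite /= sn.
  move=> y; rewrite inE mem_cat => /or3P[/eqP ->|/sG //|/mapP[z zs ->]].
    by apply: xG; rewrite inE eqxx.
  by rewrite -opA; apply: xG; rewrite inE map_f ?orbT.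
by have [y /sG] := Gm s sm.
Qed.

End Syndetic.

(** * From syndeticity to positive lower density *)

Section Counting.
Variables (R : realType) (k : nat).

Lemma le_eucl_norm (z : pvec k) i : (z i)%:R <= eucl_norm R z.
Proof.
rewrite -[leLHS]ger0_norm // -sqrtr_sqr ler_wsqrtr //.
by rewrite (bigD1 i) //= lerDl sumr_ge0 // => j _; rewrite sqr_ge0.
Qed.

Lemma eucl_norm_box (N : nat) (n : {ffun 'I_k -> 'I_N}) :
  eucl_norm R (box_pt n) <= (k * N)%:R.
Proof.
rewrite -[leRHS]ger0_norm // -sqrtr_sqr ler_wsqrtr //.
apply: (@le_trans _ _ (\sum_(i < k) N%:R ^+ 2)).
  by apply: ler_sum => i _; rewrite lerXn2r ?nnegrE // ler_nat ffunE /= ltn_ord.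
rewrite sumr_const card_ord -[_ *+ k]mulr_natl -!natrX -natrM ler_nat expnMn.
by rewrite leq_mul2r; case: (k) => [|l]; rewrite ?orbT // leq_pmulr ?orbT.
Qed.

Lemma box_pt_inj (N : nat) : injective (@box_pt k N).
Proof.
move=> n n' /ffunP nn; apply/ffunP => i; have := nn i; rewrite !ffunE.
by move=> [] /ord_inj.
Qed.

Lemma box_pt_surj (N : nat) (z : pvec k) : (forall i, (z i <= N)%N) ->
  exists n : {ffun 'I_k -> 'I_N}, box_pt n = z.
Proof.
move=> zN; have zlt i : ((z i).-1 < N)%N by rewrite prednK ?zN // posnat_gt0.
exists [ffun i => Ordinal (zlt i)]; apply/ffunP => i; rewrite !ffunE.
by apply: val_inj => /=; rewrite prednK // posnat_gt0.
Qed.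

(** Translating each point by a suitable element of [F] maps the box of side
    [N %/ M] into the part of [G] in the box of side [N]; by cancellation, at most
    [size F] points have the same image. *)
Lemma box_density (op : pvec k -> pvec k -> pvec k) (G : set (pvec k))
    (F : seq (pvec k)) :
  subordinated R op -> left_injective op ->
  (forall x, exists2 b, b \in F & G (op x b)) ->
  exists c : nat, (0 < c)%N /\ forall N, (c <= N)%N ->
    (N ^ k <= c * #|[set n : {ffun 'I_k -> 'I_N} | `[< G (box_pt n) >]]%SET|)%N.
Proof.
move=> [C [C0 Cop]] opI HF.
have /boolp.choice[bt btP] : forall x, exists b, b \in F /\ G (op x b).
  by move=> x; have [b bF Gb] := HF x; exists b.
(* Translation by an element of [F] multiplies the side of a box by at most
   [t], since the norm on the box of side [Q] is at most [k * Q]. *)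
pose t : R := C * k%:R * \sum_(b <- F) eucl_norm R b.
have norm0 (z : pvec k) : 0 <= eucl_norm R z by exact: sqrtr_ge0.
have t0 : 0 <= t by rewrite !mulr_ge0 ?(ltW C0) ?sumr_ge0.
pose M := (Num.bound t).+1.
have tM : t <= M%:R.
  by apply: (le_trans (ltW (archi_boundP t0))); rewrite ler_nat.
have F0 : (0 < size F)%N.
  by have [b + _] := HF [ffun=> posnatS 0]; case: (F).
have M0 : (0 < (2 * M) ^ k)%N by rewrite expn_gt0.
exists (M * (size F * (2 * M) ^ k))%N; split; first by rewrite !muln_gt0 F0.
move=> N cN; have MN : (M <= N)%N.
  by apply: leq_trans cN; rewrite leq_pmulr // muln_gt0 F0.
set GN := finset _.
pose Q := (N %/ M)%N.
have opN (n : {ffun 'I_k -> 'I_Q}) b i : b \in F -> (op (box_pt n) b i <= N)%N.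
  move=> bF; apply: (@leq_trans (M * Q)); last by rewrite mulnC leq_divM.
  rewrite -(ler_nat R); apply: le_trans (le_eucl_norm _ i) _.
  apply: le_trans (Cop _ _) _; rewrite natrM.
  apply: (@le_trans _ _ (t * Q%:R)); last by rewrite ler_wpM2r.
  have -> : t * Q%:R = C * (k * Q)%:R * \sum_(b <- F) eucl_norm R b.
    by rewrite /t natrM; ring.
  apply: ler_pM => //.
  - by rewrite mulr_ge0 // ltW.
  - by rewrite ler_pM2l // eucl_norm_box.
  - by rewrite (big_rem b) //= lerDl sumr_ge0.
have /boolp.choice[pi piP] : forall n : {ffun 'I_k -> 'I_Q},
    exists m : {ffun 'I_k -> 'I_N}, box_pt m = op (box_pt n) (bt (box_pt n)).
  move=> n; apply: box_pt_surj => i; apply: opN.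
  exact: (btP _).1.
have idxF n : (index (bt n) F < size F)%N by rewrite index_mem (btP n).1.
pose h (n : {ffun 'I_k -> 'I_Q}) := (Ordinal (idxF (box_pt n)), pi n).
have h_inj : injective h.
  move=> n n' [idx pin]; have bb : bt (box_pt n) = bt (box_pt n').
    rewrite -(nth_index (box_pt n) (btP (box_pt n)).1) idx.
    by rewrite nth_index // (btP _).1.
  have := congr1 (@box_pt k N) pin; rewrite !piP bb => /opI.
  exact: box_pt_inj.
have cardQ : (Q ^ k <= size F * #|GN|)%N.
  have -> : (Q ^ k = #|{: {ffun 'I_k -> 'I_Q}}|)%N by rewrite card_ffun !card_ord.
  rewrite -(card_codom h_inj) -[X in (X * _)%N]card_ord -cardsT -cardsX.
  apply/subset_leq_card/fintype.subsetP => _ /codomP[n ->].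
  by rewrite finset.in_setX !finset.inE /=; apply/asboolP; rewrite piP; apply: (btP _).2.
apply: (@leq_trans ((2 * M * Q) ^ k)).
  case: (posnP k) => [->|k0] //; rewrite leq_exp2r //.
  have NE := divn_eq N M; have Nm : (N %% M < M)%N by rewrite ltn_mod.
  have Q0 : (0 < Q)%N by rewrite divn_gt0.
  rewrite {1}NE -/Q -mulnA mul2n -addnn (mulnC Q) leq_add2l.
  by rewrite (leq_trans (ltnW Nm)) // leq_pmulr.
rewrite expnMn; apply: leq_trans (leq_mul (leqnn _) cardQ) _.
rewrite !mulnA leq_mul2r; apply/orP; right.
by rewrite mulnC -mulnA leq_pmull.
Qed.

Lemma limn_einf_ge (u : nat -> \bar R) (c : \bar R) (N0 : nat) :
  (forall N, (N0 <= N)%N -> (c <= u N)%E) -> (c <= limn_einf u)%E.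
Proof.
move=> cu; rewrite limn_einf_lim; apply: lime_ge; first exact: is_cvg_einfs.
exists N0 => // n /= N0n; apply: le_ereal_inf_tmp => _ [m /= nm <-].
by apply/cu/(leq_trans N0n).
Qed.

End Counting.

Theorem theorem1p4 (R : realType) (d : measure_display) (X : measurableType d)
    (mu : probability X R) (T : posnat -> X -> X) (HT : mul_system mu T)
    (A : set X) (mA : measurable A) (muA : (0 < mu A)%E)
    (k : nat) (k_gt0 : (0 < k)%N) (f : pvec k -> posnat)
    (Hf : comm_parametrized_multiplicative R (fun n => (f n : nat)%:R : rat))
    (ell : nat) (ell_gt0 : (0 < ell)%N) :
  (0 < limn_einf (fun N : nat => box_avg N (fun n : pvec k =>
     mu (A `&` \bigcap_(j in [set j | (1 <= j <= ell)%N])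
                 (T (posnat_exp (f n) j) @^-1` A)))))%E.
Proof.
have [_ _ [mul [opA opS fopQ _ [opI _]]]] := Hf.
have fop n m : f (mul n m) = (f n * f m)%N :> nat.
  by have /eqP := fopQ n m; rewrite -natrM eqr_nat => /eqP.
have [I [th [th0 Hth]]] := IP_recurrence HT mA muA ell.
pose G : set (pvec k) := [set n | (th%:E <= mu (return_set T A ell (f n)))%E].
pose x0 : pvec k := [ffun=> posnatS 0].
have [F HF] : exists F : seq (pvec k), forall x, exists2 b, b \in F & G (mul x b).
  apply: (syndetic_of_IP (m := #|I|) x0 opA) => s sI.
  have [S [m [[i Si] mE Hm]]] := Hth (fun i => f (nth x0 s (enum_rank i))).
  pose p (j : nat) := [exists i, S i && (enum_rank i == j :> nat)].
  have [|y ys fy] := @subproductsP _ mul f x0 s p fop.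
    exists (enum_rank i); first by rewrite sI.
    by apply/existsP; exists i; rewrite Si eqxx.
  exists y => //; rewrite /G /= (_ : f y = m) //; apply: val_inj => /=.
  rewrite fy mE sI (reindex (@enum_rank I)) /=; last exact/onW_bij/enum_rank_bij.
  apply: eq_bigl => j; apply/existsP/idP => [[j' /andP[Sj']]|Sj].
    by move=> /eqP/ord_inj/enum_rank_inj <-.
  by exists j; rewrite Sj eqxx.
have [c [c0 Hc]] := box_density opS opI HF.
apply: (@lt_le_trans _ _ (th / c%:R)%:E).
  by rewrite lte_fin divr_gt0 // ltr0n.
apply: (@limn_einf_ge _ _ _ c) => N cN.
have N0 : (0 < N ^ k)%N by rewrite expn_gt0 (leq_trans c0 cN).
apply: (@le_trans _ _ (((N ^ k)%:R^-1)%:E *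
    \sum_(n : {ffun 'I_k -> 'I_N} | `[< G (box_pt n) >]) th%:E)%E).
  rewrite sumEFin sumr_const -EFinM lee_fin -[_ *+ #|_|]mulr_natr.
  rewrite ler_pdivrMr ?ltr0n // -mulrA [leRHS]mulrC ler_pdivlMr ?ltr0n //.
  rewrite -mulrA ler_pM2l // -natrM ler_nat mulnC.
  by apply: leq_trans (Hc N cN) _; rewrite cardsE.
rewrite /box_avg lee_wpmul2l ?lee_fin ?invr_ge0 //.
rewrite [leRHS](bigID (fun n => `[< G (box_pt n) >])) /=.
rewrite -[leLHS]adde0; apply: leeD; last by apply: sume_ge0.
by apply: lee_sum => n /asboolP.
Qed.
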